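(* Let $X$ be a minimal subshift. Then $X$ has linear-growth complexity, i.e. $\limsup_{n\to+\infty} p_X(n)/n < +\infty$, if and only if there exist $d > 0$ and an $\mathcal{S}$-adic sequence $\boldsymbol{\sigma} = (\sigma_n\colon \mathcal{A}_{n+1}\to\mathcal{A}_n^+)_{n\geq 0}$ generating $X$ such that the following hold: (P1) for every $n\geq 0$, $\#\big(\mathrm{root}\,\sigma_{[0,n)}(\mathcal{A}_n)\big) \leq d$; (P2) for every $n\geq 0$ and all $a,b\in\mathcal{A}_n$, $|\sigma_{[0,n)}(a)| \leq d\cdot|\sigma_{[0,n)}(b)|$; (P3) for every $n\geq 1$ and all $a\in\mathcal{A}_n$, $|\sigma_{n-1}(a)| \leq d$.
   Context: An alphabet is a finite nonempty set $\mathcal{A}$; $\mathcal{A}^+$ is the set of nonempty finite words over $\mathcal{A}$, and $|w|$ is the length of a word $w$. The shift $S$ on $\mathcal{A}^{\mathbb{Z}}$ (product of discrete topologies) is $S((x_n)_n)=(x_{n+1})_n$. A subshift is a closed set $X\subseteq\mathcal{A}^{\mathbb{Z}}$ with $S(X)=X$; it is minimal if it is nonempty and contains no closed, $S$-invariant subset other than $\emptyset$ and $X$. $p_X(n)$ is the number of words of length $n$ that occur in at least one $x\in X$. A map $\tau\colon\mathcal{A}\to\mathcal{B}^+$ is extended by concatenation to $\mathcal{A}^+\to\mathcal{B}^+$. An $\mathcal{S}$-adic sequence is a sequence $\boldsymbol{\sigma}=(\sigma_n\colon\mathcal{A}_{n+1}\to\mathcal{A}_n^+)_{n\ge0}$ of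 such maps, where the $\mathcal{A}_n$ are alphabets. For $n\ge1$, $\sigma_{[0,n)}=\sigma_0\circ\sigma_1\circ\cdots\circ\sigma_{n-1}\colon\mathcal{A}_n\to\mathcal{A}_0^+$; $\sigma_{[0,0)}$ is the identity. The subshift generated by $\boldsymbol{\sigma}$ is $X_{\boldsymbol{\sigma}}\subseteq\mathcal{A}_0^{\mathbb{Z}}$, where $x\in X_{\boldsymbol{\sigma}}$ if and only if for every $\ell\geq0$ the word $x_{[-\ell,\ell)}=x_{-\ell}\cdots x_{\ell-1}$ occurs in $\sigma_{[0,n)}(a)$ for some $n\ge1$ and $a\in\mathcal{A}_n$. $\boldsymbol{\sigma}$ generates $X$ if $X_{\boldsymbol{\sigma}}=X$. For a nonempty word $u$, $\mathrm{root}\,u$ is the shortest prefix $v$ of $u$ such that $u=v^k$ for some $k\ge1$; for a set of words $\mathcal{W}$, $\mathrm{root}\,\mathcal{W}=\{\mathrm{root}\,w: w\in\mathcal{W}\}$. $\#$ denotes cardinality. *)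

(* Defs.v *)
From HB Require Import structures.
From mathcomp Require Import all_boot all_order all_algebra finmap.
From mathcomp Require Import all_classical all_reals all_analysis.
Set Implicit Arguments.
Unset Strict Implicit.
Unset Printing Implicit Defensive.
Import Order.TTheory GRing.Theory Num.Theory.
Local Open Scope classical_set_scope.
Local Open Scope ring_scope.

(* Alphabets are finTypes; nonemptiness is stated separately. *)

Definition fullshift (A : finType) : Type :=
  prod_topology (fun _ : int => discrete_topology A).

HB.instance Definition _ (A : finType) := Topological.copy (fullshift A)
  (prod_topology (fun _ : int => discrete_topology A)).

Definition shift (A : finType) (x : fullshift A) : fullshift A :=
  fun n => x (n + 1).

Definition shift_invariant (A : finType) (X : set (fullshift A)) : Prop :=
  @shift A @` X = X.

Definition subshift (A : finType) (X : set (fullshift A)) : Prop :=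
  closed X /\ shift_invariant X.

Definition minimal_subshift (A : finType) (X : set (fullshift A)) : Prop :=
  [/\ subshift X, X !=set0 &
    forall Y : set (fullshift A), Y `<=` X -> closed Y -> shift_invariant Y ->
      Y = set0 \/ Y = X].

Definition window (A : finType) (x : fullshift A) (i : int) (n : nat) : seq A :=
  mkseq (fun k => x (i + k%:Z)) n.

Definition occurs_in (A : finType) (w : seq A) (x : fullshift A) : Prop :=
  exists i : int, window x i (size w) = w.

Definition complexity (A : finType) (X : set (fullshift A)) (n : nat) : nat :=
  #|[pred w : n.-tuple A | `[< exists2 x, X x & occurs_in w x >]]|.

(* At n = 0 the quotient is 0 by convention; the limsup does not see it. *)
Definition linear_growth (R : realType) (A : finType) (X : set (fullshift A)) :
    Prop :=
  (limn_esup (fun n : nat => ((complexity X n)%:R / n%:R : R)%:E) < +oo)%E.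

(* A_0 is A itself and A_(n+1) is B n, so that no transport along an equality
   of types is needed to compare the generated subshift with a subset of A^Z. *)
Definition alph_seq (A : finType) (B : nat -> finType) (n : nat) : finType :=
  if n is m.+1 then B m else A.

Record sadic (A : finType) := SAdic {
  upper_alph : nat -> finType;
  morph : forall n : nat,
    alph_seq A upper_alph n.+1 -> seq (alph_seq A upper_alph n);
  alph_nonempty : forall n : nat, (0 < #|alph_seq A upper_alph n|)%N;
  morph_nonempty : forall (n : nat) (a : alph_seq A upper_alph n.+1),
    morph a != [::] }.

Definition alph (A : finType) (s : sadic A) (n : nat) : finType :=
  alph_seq A (upper_alph s) n.

Definition sigma (A : finType) (s : sadic A) (n : nat) :
    alph s n.+1 -> seq (alph s n) :=
  @morph A s n.

Definition extend (A B : Type) (tau : A -> seq B) (w : seq A) : seq B :=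
  flatten (map tau w).

(* sigma_upto s n is sigma_[0,n), i.e.
   sigma_[0,n+1) = sigma_[0,n) \o sigma_n, starting from the identity. *)
Fixpoint sigma_upto (A : finType) (s : sadic A) (n : nat) :
    alph s n -> seq A :=
  match n return alph s n -> seq A with
  | 0 => fun a => [:: a]
  | m.+1 => fun a => extend (@sigma_upto A s m) (@sigma A s m a)
  end.

Definition generated_subshift (A : finType) (s : sadic A) :
    set (fullshift A) :=
  [set x | forall l : nat, exists n : nat, (1 <= n)%N /\
     exists a : alph s n, infix (window x (- l%:Z) l.*2) (sigma_upto a)].

Definition generates (A : finType) (s : sadic A) (X : set (fullshift A)) :
    Prop :=
  generated_subshift s = X.

Definition word_pow (T : Type) (v : seq T) (k : nat) : seq T :=
  flatten (nseq k v).

Definition is_root_length (T : eqType) (u : seq T) (m : nat) : bool :=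
  `[< exists2 k : nat, (1 <= k)%N & u = word_pow (take m u) k >].

Lemma ex_root_length (T : eqType) (u : seq T) :
  exists m, is_root_length u m.
Proof.
exists (size u); apply/asboolP; exists 1%N => //.
by rewrite /word_pow /= cats0 take_size.
Qed.

(* On the empty word this is the empty word. *)
Definition root_word (T : eqType) (u : seq T) : seq T :=
  take (ex_minn (ex_root_length u)) u.

(* Main.v *)
Require Import Defs.
From HB Require Import structures.
From mathcomp Require Import all_boot all_order all_algebra finmap.
From mathcomp Require Import all_classical all_reals all_analysis.
From mathcomp Require Import zify.
Set Implicit Arguments.
Unset Strict Implicit.
Unset Printing Implicit Defensive.
Import Order.TTheory GRing.Theory Num.Theory.
Local Open Scope classical_set_scope.
Local Open Scope ring_scope.

(** Suppose first that an S-adic sequence with the three properties generates X.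
    Given k, stop at the first level where all values of the letters have length
    at least k; by balance and by the bound on the morphisms, these lengths are
    also O(k). A word of length k lies in a product of two values, that is, in a
    product of powers of two roots. It is determined by the two roots and by its
    position with respect to the seam, which leaves O(k) possibilities
    (linear_of_sadic).

    Conversely let X have linear complexity, and fix a point x of X. It is enough
    to cut x, for each n, into words whose lengths are comparable to K^n and which
    have boundedly many roots, in such a way that each word of level n+1 is a
    product of words of level n (word_system, sadic_of_word_system); X is the
    generated subshift by recurrence (word_system_generates). If x is
    periodic this is easy, so let it be aperiodic.

    The cuts of level n are chosen in a set C_n of positions that is determined by
    the letters of x at distance O(K^n). There is one way to count: if such a set is
    K^n-separated, then the number of words of length O(K^n) around its points is
    bounded, because each of them accounts for K^n words of x of length O(K^n)
    (covered_windows). Sets that are at the same time separated and syndetic do not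
    exist near long periodic stretches, since there a set determined by the letters
    has to be periodic too, with a period that may be short. So the sets C_n are
    asked to be syndetic, and separated except for chains of equally spaced points
    along which x is periodic (level). The starts of the chains are then separated,
    and their number of surrounding words is bounded.

    C_(n+1) is chosen inside C_n (select_chains). There are lengths m comparable to
    K^(n+1) for which the number of right special words of length m is bounded
    (slow_growth), while right special positions are syndetic by aperiodicity
    (syndetic_special). Move each of them back to a point of C_n, rank
    the words around the points so obtained, and keep the points of locally minimal
    rank. Points of equal rank at a short distance create a period, and
    the chains arise in this way.

    Finally the chains of C_n are cut into pieces of length about K^n, which are powers
    of one word for each chain; the other pieces run from a chain to
    the start of the next one (piece). The root of a piece is determined by the letters
    around a chain start, so there are boundedly many (covered_piece_roots).
    For the pieces of level n+1 to be products of pieces of level n, points of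
    C_(n+1) that lie in a chain of C_n have to be its start or far from its ends;
    only such points of C_n are used when C_(n+1) is chosen (settled,
    tiled_settled). *)

(** * Powers and roots of words *)

Section Words.
Variable T : eqType.
Implicit Types u v w t : seq T.

Lemma size_word_pow v k : size (word_pow v k) = (k * size v)%N.
Proof. by elim: k => //= k IH; rewrite size_cat IH mulSn. Qed.

Lemma word_powS v k : word_pow v k.+1 = v ++ word_pow v k.
Proof. by []. Qed.

Lemma word_powD v m n : word_pow v (m + n) = word_pow v m ++ word_pow v n.
Proof. by elim: m => //= m IH; rewrite addSn !word_powS IH catA. Qed.

Lemma word_powM v m n : word_pow (word_pow v m) n = word_pow v (n * m).
Proof. by elim: n => //= n IH; rewrite word_powS IH mulSn word_powD. Qed.

Lemma word_pow1 v : word_pow v 1 = v.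
Proof. exact: cats0. Qed.

Lemma nth_word_pow (a : T) v k i : (i < k * size v)%N ->
  nth a (word_pow v k) i = nth a v (i %% size v).
Proof.
elim: k i => [|k IH] i; first by rewrite mul0n.
rewrite mulSn word_powS nth_cat; case: (ltnP i (size v)) => [iv _|vi ik].
  by rewrite modn_small.
rewrite IH; last by rewrite ltn_subLR.
by rewrite -{2}(subnK vi) modnDr.
Qed.

Lemma take_word_pow v k : (0 < k)%N -> take (size v) (word_pow v k) = v.
Proof. by case: k => // k _; rewrite word_powS take_size_cat. Qed.

(** This is the Euclidean algorithm on the lengths: the shorter of two
    commuting words is a prefix of the longer one and commutes with what is
    left of it. *)
Lemma commuting_words u v : u ++ v = v ++ u ->
  exists t, (exists a, u = word_pow t a) /\ (exists b, v = word_pow t b).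
Proof.
have [n] := ubnP (size u + size v).
elim: n u v => // n IH u v.
wlog uv : u v / (size u <= size v)%N.
  move=> W ltn com; case/orP: (leq_total (size u) (size v)) => le; first exact: W.
  have [t [tv tu]] : exists t, (exists a, v = word_pow t a) /\
      (exists b, u = word_pow t b) by apply: W; rewrite // addnC.
  by exists t.
case: u uv => [|a u] uv.
  by exists v; split; [exists 0%N | exists 1%N; rewrite word_pow1].
move=> ltn com.
have := congr1 (take (size (a :: u))) com.
rewrite take_size_cat // takel_cat // => def_u.
move: ltn com; rewrite -(cat_take_drop (size (a :: u)) v) -def_u.
set w := drop _ v => ltn; rewrite -catA => /eqP; rewrite eqseq_cat // eqxx /=.
move=> /eqP com.
have [||t [[p up] [q ->]]] := IH (a :: u) w.
- by move: ltn; rewrite size_cat /=; lia.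
- by [].
- by exists t; split; [exists p | exists (p + q)%N; rewrite word_powD -up].
Qed.

Lemma root_wordP u : exists2 k, (0 < k)%N & u = word_pow (root_word u) k.
Proof. by rewrite /root_word; case: ex_minnP => m /asboolP. Qed.

Lemma size_root_word u v k : (0 < k)%N -> u = word_pow v k ->
  (size (root_word u) <= size v)%N.
Proof.
move=> k0 uv; rewrite /root_word; case: ex_minnP => m _ min.
apply: (@leq_trans m); first by rewrite size_take; case: ltnP.
by apply: min; apply/asboolP; exists k; rewrite // {2}uv take_word_pow.
Qed.

(** The root r of a power of v commutes with v, because that power is a power of
    both; so r and v are powers of one word, which is r by minimality. *)
Lemma root_word_pow v k : (0 < k)%N -> root_word (word_pow v k) = root_word v.
Proof.
move=> k0; case: (posnP (size v)) => [/size0nil ->|v0].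
  by rewrite (_ : word_pow [::] k = [::]) //; elim: k {k0}.
set u := word_pow v k; set r := root_word u.
have [i i0 ui] := root_wordP u; rewrite -/r in ui.
have min w j : (0 < j)%N -> u = word_pow w j -> (size r <= size w)%N.
  exact: size_root_word.
move: @r ui min => r ui min.
have ruE : r ++ u = u ++ r.
  by rewrite ui -{1 4}[r]word_pow1 -!word_powD addnC.
have rv : (size r <= size v)%N by apply: (min _ k).
have pre_v n : exists w, word_pow v n ++ r = r ++ w.
  have rpre : take (size r) v = r.
    rewrite -[RHS](take_word_pow r i0) -ui /u; case: (k) k0 => // k' _.
    by rewrite word_powS takel_cat.
  have vE : v = r ++ drop (size r) v by rewrite -[LHS](cat_take_drop (size r)) rpre.
  case: n => [|n]; first by exists [::]; rewrite cats0.
  exists (drop (size r) v ++ word_pow v n ++ r).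
  by rewrite word_powS -!catA {1}vE -catA.
have com : r ++ v = v ++ r.
  move: ruE; rewrite /u; case: (k) k0 => // k' _; rewrite word_powS -[in RHS]catA.
  have [w ->] := pre_v k'; rewrite !catA => /eqP; rewrite eqseq_cat.
    by case/andP => /eqP.
  by rewrite !size_cat addnC.
have [t [[b rb] [a va]]] := commuting_words com.
have r0 : (0 < size r)%N.
  case: (posnP (size r)) => // /size0nil r0; move: ui; rewrite r0 => u0.
  move: (congr1 size u0); rewrite /u !size_word_pow muln0 => /eqP.
  by rewrite muln_eq0 => /orP[]/eqP; lia.
have b1 : b = 1%N.
  have rt : (size r <= size t)%N.
    apply: (min _ (k * a)%N); last by rewrite /u va word_powM.
    by rewrite muln_gt0 k0 /=; case: (a) va v0 => // ->.
  have := congr1 size rb; rewrite size_word_pow; nia.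
have vr : v = word_pow r a by rewrite rb b1 word_pow1.
have a0 : (0 < a)%N by case: (a) vr v0 => // ->.
have [j j0 vj] := root_wordP v.
have uj : u = word_pow (root_word v) (k * j) by rewrite /u {1}vj word_powM.
have kj0 : (0 < k * j)%N by rewrite muln_gt0 k0.
have sz : size r = size (root_word v).
  by apply/eqP; rewrite eqn_leq (min _ _ kj0 uj) (size_root_word a0 vr).
by rewrite -(take_word_pow r i0) -ui sz uj take_word_pow.
Qed.

End Words.

(** * Finite sets of bounded size *)

(** Bounded size is phrased through lists, so that no finite type has to carry
    the set. *)
Definition covered (T : eqType) (S : set T) (n : nat) : Prop :=
  exists2 l : seq T, (size l <= n)%N & forall t, S t -> t \in l.

Lemma covered_rel (T U : eqType) (S : set T) (S' : set U)
    (P : T -> U -> Prop) (n : nat) :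
  covered S n ->
  (forall u, S' u -> exists2 t, S t & P t u) ->
  (forall t u u', S' u -> S' u' -> P t u -> P t u' -> u = u') ->
  covered S' n.
Proof.
move=> [l ln Sl] ex fun_P.
pose f t : option U := if pselect (exists2 u, S' u & P t u) is left e
  then Some (sval (cid2 e)) else None.
exists (pmap f l); first by rewrite size_pmap (leq_trans (count_size _ _)).
move=> u Su; have [t St Ptu] := ex u Su.
rewrite mem_pmap; apply/mapP; exists t; first exact: Sl.
rewrite /f; case: pselect => [e|[]]; last by exists u.
by case: (cid2 e) => u' Su' Pu' /=; rewrite (fun_P t u u').
Qed.

Lemma coveredU (T : eqType) (S S' : set T) (m n : nat) :
  covered S m -> covered S' n -> covered (S `|` S') (m + n).
Proof.
move=> [l lm Sl] [l' ln Sl']; exists (l ++ l').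
  by rewrite size_cat leq_add.
by move=> t [/Sl|/Sl'] H; rewrite mem_cat H ?orbT.
Qed.

Lemma covered_le (T : eqType) (S S' : set T) (m n : nat) :
  covered S m -> S' `<=` S -> (m <= n)%N -> covered S' n.
Proof.
move=> [l lm Sl] sub mn; exists l; first exact: leq_trans mn.
by move=> t /sub/Sl.
Qed.

(** * Sets of positions *)

Lemma int_least (P : set int) (y : int) : (exists2 c, y <= c & P c) ->
  exists c, [/\ y <= c, P c & forall z, y <= z -> z < c -> ~ P z].
Proof.
move=> [c yc Pc].
have ex : exists n : nat, `[< P (y + n%:Z) >].
  by exists `|c - y|%N; apply/asboolP; rewrite (_ : y + _ = c) //; lia.
case: (ex_minnP ex) => n /asboolP Pn min.
exists (y + n%:Z); split=> //; first by lia.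
move=> z yz zn Pz.
have : (n <= `|z - y|)%N.
  by apply: min; apply/asboolP; rewrite (_ : y + _ = z) //; lia.
by lia.
Qed.

Lemma int_greatest (P : set int) (y : int) : (exists2 c, c <= y & P c) ->
  exists c, [/\ c <= y, P c & forall z, z <= y -> c < z -> ~ P z].
Proof.
move=> [c cy Pc].
have [|d [yd Pd min]] := @int_least [set z | P (- z)] (- y).
  by exists (- c); [lia | rewrite /= opprK].
exists (- d); split=> //; first by lia.
move=> z zy dz Pz; apply: (min (- z)); [lia | lia |].
by rewrite /= opprK.
Qed.

Definition successive (C : set int) (i j : int) : Prop :=
  [/\ C i, C j, i < j & forall z, i < z -> z < j -> ~ C z].

Lemma successive_fun (C : set int) i j j' : successive C i j -> successive C i j' -> j = j'.
Proof.
move=> [_ Cj ij nj] [_ Cj' ij' nj'].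
have [lt|lt|//] := ltgtP j j'; first by case: (nj' j ij lt Cj).
by case: (nj j' ij' lt Cj').
Qed.

Definition syndetic (g : nat) (C : set int) : Prop :=
  forall y, exists c, [/\ C c, y <= c & c <= y + g%:Z].

(** Points at distance less than l of each other are thought of as linked into
    chains; these are the first points of the chains. *)
Definition starts (l : nat) (C : set int) : set int :=
  [set c | C c /\ forall z, C z -> z < c -> z + l%:Z <= c].

(** The points at which the next level is allowed to cut. A cut inside a chain
    but near one of its ends would leave a short part of the chain attached to
    what lies beyond that end, and the number of such combinations would not be
    bounded. *)
Definition settled (h l : nat) (C : set int) : set int :=
  [set c | C c /\ (starts l C c \/
     forall z, starts l C z -> z + h%:Z < c \/ c + h%:Z < z)].

Section Positions.
Variables (A : finType) (x : fullshift A).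
Implicit Types (i j y z t : int) (C Q : set int).

Definition agree i j (a b : nat) : Prop :=
  forall t, - a%:Z <= t -> t < b%:Z -> x (i + t) = x (j + t).

Lemma window_eqP i j n : window x i n = window x j n <-> agree i j 0 n.
Proof.
split=> [eqw t t0 tn | ag].
  have tE : t = `|t|%N%:Z by lia.
  have tlt : (`|t| < n)%N by lia.
  have := congr1 (fun w => nth (x i) w `|t|%N) eqw.
  by rewrite !nth_mkseq // -tE.
apply: (@eq_from_nth _ (x i)); rewrite !size_mkseq // => k kn.
by rewrite !nth_mkseq //; apply: ag; lia.
Qed.

Lemma agree_sub i j a b (t : int) a' b' : agree i j a b ->
  (a'%:Z <= a%:Z + t) -> (t + b'%:Z <= b%:Z) -> agree (i + t) (j + t) a' b'.
Proof. by move=> ag ha hb s s0 s1; rewrite -!addrA; apply: ag; lia. Qed.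

Lemma agree_window i j a b :
  window x (i - a%:Z) (a + b) = window x (j - a%:Z) (a + b) <-> agree i j a b.
Proof.
rewrite window_eqP; split=> ag t t0 t1.
  have E k : k - a%:Z + (t + a%:Z) = k + t by lia.
  by have := ag (t + a%:Z); rewrite !E; apply; lia.
by rewrite -!addrA; apply: ag; lia.
Qed.

Lemma agree_sym i j a b : agree i j a b -> agree j i a b.
Proof. by move=> ag t t0 t1; rewrite ag. Qed.

(** The set consists of the times at which the orbit of x visits a set defined by
    the letters at distance at most r from the origin. *)
Definition local (r : nat) C : Prop :=
  forall i j, agree i j r r -> C i -> C j.

Lemma local_shift r C i j a b (t : int) : local r C -> agree i j a b ->
  r%:Z <= a%:Z + t -> t + r%:Z <= b%:Z -> C (i + t) -> C (j + t).
Proof. by move=> loc ag ha hb; apply: loc; apply: agree_sub ag ha hb. Qed.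

Lemma local_le r r' C : (r <= r')%N -> local r C -> local r' C.
Proof. by move=> rr loc i j ag; apply: loc => t t0 t1; apply: ag; lia. Qed.

Lemma local_starts r l C : local r C -> local (r + l) (starts l C).
Proof.
move=> loc i j ag [Ci first]; split.
  by apply: loc Ci => t t0 t1; apply: ag; lia.
move=> z Cz zj; rewrite leNgt; apply/negP => lt.
have := first (i + (z - j)); suff: C (i + (z - j)) by move=> h /(_ h); lia.
apply: (local_shift loc (agree_sym ag)); [lia | lia |].
by rewrite addrC subrK.
Qed.

Lemma local_settled r h l C : local r C -> local (r + l + h) (settled h l C).
Proof.
move=> loc i j ag [Ci st]; have locS := local_starts (l := l) loc; split.
  by apply: loc Ci => t t0 t1; apply: ag; lia.
case: st => [Si|far]; [left | right].
  by apply: locS Si => t t0 t1; apply: ag; lia.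
move=> z Sz; have [lt|le] := ltP (z + h%:Z) j; first by left.
have [lt|le'] := ltP (j + h%:Z) z; first by right.
have := far (i + (z - j)); suff: starts l C (i + (z - j)) by move=> s /(_ s); lia.
apply: (local_shift locS (agree_sym ag)); [lia | lia |].
by rewrite addrC subrK.
Qed.

(** Look h beyond a given position: a point of C found there is either settled
    or within h of a chain start, which is settled. *)
Lemma syndetic_settled g h l C : syndetic g C ->
  syndetic (g + h + h) (settled h l C).
Proof.
move=> syn y; have [c [Cc yc cy]] := syn (y + h%:Z).
have [near|far] := pselect (exists z, [/\ starts l C z, c <= z + h%:Z & z <= c + h%:Z]).
  have [z [Sz zc cz]] := near; exists z; split; [|lia|lia].
  by split; [case: Sz | left].
exists c; split; [|lia|lia]; split=> //; right=> z Sz.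
have [lt|le] := ltP (z + h%:Z) c; first by left.
have [lt|le'] := ltP (c + h%:Z) z; first by right.
by case: far; exists z.
Qed.

(** In long periodic stretches C cannot be separated. There it is made of chains
    instead, whose points are equally spaced by a period of x. *)
Record level (D : nat) C (l : nat) : Prop := Level {
  level_local : local (9 * l) C;
  level_syndetic : syndetic (D * l) C;
  level_chain : forall c c' c'', successive C c c' -> successive C c' c'' ->
    c' - c < l%:Z -> c'' - c' < l%:Z ->
    c' - c = c'' - c' /\ agree c c' 0 `|c' - c| }.

(** The word of length m that ends before e is right special. *)
Definition special (m : nat) (e : int) : Prop :=
  exists e', agree e e' m 0 /\ x e <> x e'.

(** The words around certain points of Q are ranked, and C consists of the points
    of locally minimal rank. The ranked words are those around the last points of
    Q at least r before the right special positions: this makes their number at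
    most that of the right special words, and the points that carry them syndetic.
    The points of C have the same rank as soon as they are less than l apart,
    hence the same word around them, so that a chain is a stretch of one period.
    Two unequal consecutive gaps would both be periods of the middle part, and
    translating by the shorter one would exhibit a point of C inside the longer
    gap. *)
Lemma select_chains Q (r g m l n s : nat) :
  local r Q -> syndetic g Q ->
  covered [set u | exists2 e, special m e & u = window x (e - m%:Z) m] n ->
  syndetic s [set e | special m e] ->
  (2 * r + g + 2 * l <= m)%N ->
  exists C, [/\ C `<=` Q, local (m + l) C, syndetic (r + g + s + 2 * (n * l)) C &
    forall c c' c'', successive C c c' -> successive C c' c'' ->
      c' - c < l%:Z -> c'' - c' < l%:Z ->
      c' - c = c'' - c' /\ agree c c' 0 `|c' - c|].
Proof.
move=> locQ synQ cov synE rglm.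
pose mu := (m - r - g)%N.
(* The word around rho e, of radius mu on the left and r on the right, lies in
   the word of length m before e, which also determines rho e - e. *)
pose word q := window x (q - mu%:Z) (mu + r).
pose rho e q := [/\ Q q, q + r%:Z <= e & forall z, Q z -> z + r%:Z <= e -> z <= q].
have rho_bound e q : rho e q -> e <= q + r%:Z + g%:Z.
  move=> [_ _ max]; have [c [Qc c1 c2]] := synQ (e - r%:Z - g%:Z).
  have := max c Qc; lia.
have rho_ex e : exists q, rho e q.
  have [|q [qe Qq max]] := @int_greatest Q (e - r%:Z).
    by have [c [Qc c1 c2]] := synQ (e - r%:Z - g%:Z); exists c => //; lia.
  exists q; split=> //; first by lia.
  move=> z Qz ze; rewrite leNgt; apply/negP => lt; apply: (max z) => //; lia.
have rho_shift e e' q q' : agree e e' m 0 -> rho e q -> rho e' q' -> q - e <= q' - e'.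
  move=> ag rq rq'; have := rho_bound _ _ rq; case: rq => Qq qe _ b.
  case: rq' => _ _ max; have := max (e' + (q - e)).
  suff: Q (e' + (q - e)) by move=> h /(_ h); lia.
  by apply: (local_shift locQ ag); [lia | lia | rewrite addrC subrK].
have [T Tn TP] : covered [set w | exists2 e, special m e & exists2 q, rho e q & w = word q] n.
  apply: (covered_rel (P := fun u w => exists e q,
     [/\ special m e, u = window x (e - m%:Z) m, rho e q & w = word q]) cov).
    move=> w [e se [q rq wq]]; exists (window x (e - m%:Z) m); first by exists e.
    by exists e, q.
  move=> u w w' _ _ [e [q [_ ue rq ->]]] [e' [q' [_ ue' rq' ->]]].
  have ag : agree e e' m 0 by apply/agree_window; rewrite addn0 -ue -ue'.
  have eqs : q - e = q' - e'.
    apply/eqP; rewrite eq_le (rho_shift _ _ _ _ ag rq rq') /=.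
    exact: (rho_shift _ _ _ _ (agree_sym ag) rq' rq).
  have b := rho_bound _ _ rq; case: (rq) => _ qe _.
  apply/agree_window; rewrite (_ : q = e + (q - e)); last by lia.
  rewrite (_ : q' = e' + (q - e)); last by lia.
  by apply: agree_sub ag _ _; rewrite /mu; lia.
pose Q' := [set q | Q q /\ word q \in T].
pose rank q := index (word q) T.
pose C := [set c | Q' c /\ forall z, Q' z -> `|z - c| < l%:Z -> (rank c <= rank z)%N].
have same i j : agree i j mu r -> Q' i -> Q' j /\ rank j = rank i.
  move=> ag [Qi wi].
  have eqw : word j = word i by apply/esym; apply/agree_window.
  split; last by rewrite /rank eqw.
  split; last by rewrite eqw.
  by apply: locQ Qi => t t0 t1; apply: ag; lia.
have C_same c c' : C c -> C c' -> `|c' - c| < l%:Z -> agree c c' mu r.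
  move=> [Qc minc] [Qc' minc'] lt; apply/agree_window.
  have rk : rank c = rank c'.
    by apply/eqP; rewrite eqn_leq minc // minc' // distrC.
  case: Qc Qc' => _ wc [_ wc'].
  by rewrite -[LHS](nth_index [::] wc) -[RHS](nth_index [::] wc') -/(rank c) rk.
have C_between c c' z : C c -> C c' -> c' - c < l%:Z -> c < z -> z < c' ->
    agree c z mu r -> C z.
  move=> Cc Cc' lt cz zc' ag; have [Qz rkz] := same _ _ ag (proj1 Cc).
  split=> // w Qw wz; rewrite rkz.
  have rk : rank c' = rank c.
    apply: (proj2 (same _ _ _ (proj1 Cc))); apply: C_same => //; lia.
  have [wc'|c'w] := leP w c'; last by rewrite -rk; apply: (proj2 Cc') => //; lia.
  by apply: (proj2 Cc) => //; lia.
exists C; split.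
- by move=> c [[]].
- move=> i j ag [Qi mini].
  have sub t : `|t| <= l%:Z -> agree (i + t) (j + t) mu r.
    by move=> tl; apply: agree_sub ag _ _; rewrite /mu; lia.
  have [] := same i j _ Qi; first by have := sub 0; rewrite !addr0; apply.
  move=> Qj rkj; split=> // z Qz zj; rewrite rkj.
  have ag' := sub (z - j) (ltW zj).
  rewrite (addrC j) subrK in ag'.
  have [Qz' rkz] := same _ _ (agree_sym ag') Qz.
  by rewrite -rkz; apply: mini => //; lia.
(* Moving to a point of smaller rank at distance less than l, as long as there is
   one, takes at most n moves. *)
- have descend : forall k q, Q' q -> (rank q < k)%N ->
      exists c, [/\ C c, q - (k * l)%:Z <= c & c <= q + (k * l)%:Z].
    elim=> // k IH q Qq rk.
    have [Cq|nC] := pselect (C q); first by exists q; split=> //; lia.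
    have [z [Qz zq rz]] : exists z, [/\ Q' z, `|z - q| < l%:Z & (rank z < rank q)%N].
      apply: contrapT => no; apply: nC; split=> // z Qz zq.
      by rewrite leqNgt; apply/negP => lt; apply: no; exists z.
    have [|c [Cc c1 c2]] := IH z Qz; first by apply: leq_trans rz _; rewrite -ltnS.
    by exists c; split=> //; rewrite mulSn; lia.
  move=> y; have [e [se ye ey]] := synE (y + (n * l)%:Z + r%:Z + g%:Z).
  have [q rq] := rho_ex e; have b := rho_bound _ _ rq.
  have Qq : Q' q by split; [case: rq | apply: TP; exists e => //; exists q].
  have [|c [Cc c1 c2]] := descend n q Qq.
    by apply: leq_trans Tn; rewrite index_mem; case: Qq.
  by case: rq => _ qe _; exists c; split=> //; lia.
- move=> c c' c'' [Cc Cc' cc' no] [_ Cc'' cc'' no'] lt lt'.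
  have ag : agree c c' mu r by apply: C_same => //; lia.
  have ag' : agree c' c'' mu r by apply: C_same => //; lia.
  have per t : c - mu%:Z <= t -> t < c + r%:Z -> x t = x (t + (c' - c)).
    move=> t0 t1; have := ag (t - c); rewrite (addrC c) subrK => ->; [|lia|lia].
    by congr (x _); lia.
  have per' t : c' - mu%:Z <= t -> t < c' + r%:Z -> x t = x (t + (c'' - c')).
    move=> t0 t1; have := ag' (t - c'); rewrite (addrC c') subrK => ->; [|lia|lia].
    by congr (x _); lia.
  set p := c' - c in per; set p' := c'' - c' in per'.
  have eqp : p = p'.
    have [pp'|pp'|//] := ltgtP p p'.
    + case: (no' (c' + p)); [lia | lia |].
      apply: (C_between c' c'') => //; [lia | lia |].
      move=> t t0 t1.
      have [close|far] := ltP (c' + t) (c + r%:Z).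
        rewrite per; [|lia|lia]; congr (x _); lia.
      rewrite (_ : c' + t = c' + t - p' + p'); last by lia.
      rewrite (_ : c' + p + t = c' + t - p' + p + p'); last by lia.
      by rewrite -per' -?per' -?per //; lia.
    + case: (no (c' - p')); [lia | lia |].
      apply: (C_between c c') => //; [lia | lia |].
      move=> t t0 t1; rewrite ag //.
      have [close|far] := leP (c' - mu%:Z) (c' - p' + t).
        rewrite [RHS]per'; [|lia|lia]; congr (x _); lia.
      rewrite [RHS]per; [|lia|lia]; rewrite [RHS]per'; [|lia|lia].
      rewrite [LHS]per; [|lia|lia]; congr (x _); lia.
  split=> // t t0 t1.
  have := ag' (t - p); rewrite (_ : c' + (t - p) = c + t); last by lia.
  rewrite (_ : c'' + (t - p) = c' + t); last by lia.
  by apply; rewrite /mu; lia.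
Qed.

End Positions.

(** * Counting the words of a point *)

Section Counting.
Variables (A : finType) (x : fullshift A).
Implicit Types (i j y z t : int).

Lemma window_size i n : size (window x i n) == n.
Proof. by rewrite size_mkseq. Qed.

Definition window_tuple i n : n.-tuple A := Tuple (window_size i n).

Definition words n : {set n.-tuple A} :=
  [set w : n.-tuple A | `[< exists i, window x i n = w >]]%SET.

Lemma in_words n (w : n.-tuple A) :
  reflect (exists i, w = window_tuple i n) (w \in words n).
Proof.
rewrite inE; apply: (iffP (asboolP _)) => -[i wi]; exists i.
  by apply: val_inj; rewrite /= wi.
by rewrite wi.
Qed.

Lemma window_cat i m n :
  window x i (m + n) = window x i m ++ window x (i + m%:Z) n.
Proof.
rewrite /window /mkseq iotaD map_cat; congr (_ ++ _).
rewrite add0n -[m in iota m n]addn0 iotaDl -map_comp; apply: eq_map => k /=.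
congr (x _); lia.
Qed.

(** Each right special word has a second right extension, besides one that can
    be chosen for each word. *)
Lemma covered_special m : covered
  [set u | exists2 e, special x m e & u = window x (e - m%:Z) m]
  (#|words m.+1| - #|words m|).
Proof.
pose S := [set u : m.-tuple A |
  `[< exists2 e, special x m e & u = window_tuple (e - m%:Z) m >]]%SET.
have pos (u : m.-tuple A) : u \in words m -> {e | u = window_tuple (e - m%:Z) m}.
  move=> /in_words uw; apply: cid; case: uw => i ->.
  by exists (i + m%:Z); rewrite addrK.
pose e1 u := if boolP (u \in words m) is AltTrue h then sval (pos u h) else 0.
have e1P u : u \in words m -> u = window_tuple (e1 u - m%:Z) m.
  move=> uw; rewrite /e1; case: {-}_ / boolP => [h|]; last by rewrite uw.
  by case: (pos u h).
have sp u : u \in S -> {e | u = window_tuple (e - m%:Z) m & x e <> x (e1 u)}.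
  rewrite inE => /asboolP us; apply: cid2; case: us => e [e' [ag ne]] ue.
  have uw : u \in words m by apply/in_words; exists (e - m%:Z).
  have [eq|] := pselect (x e = x (e1 u)); last by exists e.
  exists e'; last by rewrite -eq => /esym.
  rewrite ue; apply: val_inj => /=; apply/esym.
  by have /agree_window := ag; rewrite addn0.
pose e2 u := if boolP (u \in S) is AltTrue h then s2val (sp u h) else 0.
have e2P u : u \in S -> u = window_tuple (e2 u - m%:Z) m /\ x (e2 u) <> x (e1 u).
  move=> us; rewrite /e2; case: {-}_ / boolP => [h|]; last by rewrite us.
  by case: (sp u h).
pose ext (e : int) := window_tuple (e - m%:Z) m.+1.
have ext_eq e e' : ext e = ext e' ->
    window_tuple (e - m%:Z) m = window_tuple (e' - m%:Z) m /\ x e = x e'.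
  move=> /(congr1 val) /= /window_eqP eq; split.
    by apply: val_inj; apply/window_eqP => t t0 t1; apply: eq; lia.
  by have := eq m%:Z; rewrite !subrK; apply; lia.
have inj1 : {in words m &, injective (ext \o e1)}.
  by move=> u v uw vw /ext_eq[eq _]; rewrite (e1P u) // (e1P v).
have inj2 : {in S &, injective (ext \o e2)}.
  move=> u v us vs /ext_eq[eq _].
  by rewrite (proj1 (e2P u us)) (proj1 (e2P v vs)).
have sub1 : (ext \o e1) @: words m \subset words m.+1.
  by apply/fintype.subsetP => _ /imsetP[u _ ->]; apply/in_words; exists (e1 u - m%:Z).
have sub2 : (ext \o e2) @: S \subset words m.+1.
  by apply/fintype.subsetP => _ /imsetP[u _ ->]; apply/in_words; exists (e2 u - m%:Z).
have dis : ((ext \o e1) @: words m :&: (ext \o e2) @: S = finset.set0)%SET.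
  apply/finset.setP => w; rewrite finset.in_setI finset.in_set0.
  apply/negbTE/negP => /andP[/imsetP[u uw ->] /imsetP[v vs]].
  move=> /ext_eq[eq1 eq2]; have [vE] := e2P v vs; case.
  by rewrite -eq2 vE -eq1 -e1P.
have card : (#|words m| + #|S| <= #|words m.+1|)%N.
  rewrite -(card_in_imset inj1) -(card_in_imset inj2) -cardsUI.
  rewrite dis cards0 addn0; apply: subset_leq_card.
  by rewrite finset.subUset sub1 sub2.
exists (map val (enum S)).
  by rewrite size_map -cardE leq_subRL // (leq_trans _ card) // leq_addr.
move=> u [e se ->]; apply/mapP; exists (window_tuple (e - m%:Z) m) => //.
by rewrite mem_enum inE; apply/asboolP; exists e.
Qed.

(** Otherwise the increments between n and 2n add up to more than 2cn. *)
Lemma slow_growth c n : (0 < n)%N ->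
  (forall k, (0 < k)%N -> (#|words k| <= c * k)%N) ->
  exists m, [/\ (n <= m)%N, (m < 2 * n)%N &
    (#|words m.+1| - #|words m| <= 2 * c)%N].
Proof.
move=> n0 lin; apply: contrapT => no.
have grow k : (k <= n)%N -> (k * (2 * c).+1 <= #|words (n + k)|)%N.
  elim: k => // k IH kn; rewrite mulSn addnS.
  have := IH (ltnW kn).
  have [|lt] := leqP (#|words (n + k).+1| - #|words (n + k)|) (2 * c).
    by move=> le; case: no; exists (n + k)%N; split=> //; lia.
  by lia.
have := grow n (leqnn n); have := lin (n + n)%N; nia.
Qed.

(** Without a right special position the word of length m at each position
    determines the next one; once such a word is repeated, the point is
    periodic from there on. *)
Lemma syndetic_special m :
  (forall q y, 0 < q -> ~ forall t, y <= t -> x (t + q) = x t) ->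
  syndetic #|words m| [set e | special x m e].
Proof.
move=> aper y; apply: contrapT => no.
have {}no e : y <= e -> e <= y + #|words m|%:Z -> ~ special x m e.
  by move=> e0 e1 se; apply: no; exists e.
pose f (k : 'I_(#|words m|).+1) := window_tuple (y + k%:Z - m%:Z) m.
have /injectivePn[k1 [k2 k12 eqf]] : ~~ injectiveb f.
  apply/negP => /injectiveP inj_f; have := card_imset predT inj_f.
  rewrite card_ord => card; have : (f @: predT \subset words m).
    by apply/fintype.subsetP => _ /imsetP[k _ ->]; apply/in_words; eexists.
  by move=> /subset_leq_card; rewrite card ltnn.
wlog lt : k1 k2 k12 eqf / (k1 < k2)%N.
  move=> W; have := k12; rewrite -val_eqE neq_ltn => /orP[] lt; first exact: (W k1 k2).
  by apply: (W k2 k1); rewrite // eq_sym.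
pose e := y + k1%:Z; pose q : int := k2%:Z - k1%:Z.
have main (n : nat) : agree x (e + n%:Z) (e + n%:Z + q) m 0 /\ ~ special x m (e + n%:Z).
  elim/ltn_ind: n => n IH.
  have ag : agree x (e + n%:Z) (e + n%:Z + q) m 0.
    case: n IH => [_|n /(_ n (ltnSn n))[ag nsp]].
      apply/agree_window; rewrite addn0 /e /q addr0.
      rewrite (_ : y + k1%:Z + (k2%:Z - k1%:Z) = y + k2%:Z); last by lia.
      by have := congr1 val eqf.
    have next_letter : x (e + n%:Z) = x (e + n%:Z + q).
      by apply: contrapT => ne; apply: nsp; exists (e + n%:Z + q).
    move=> t t0 t1; have [tE|tn] := eqVneq t (-1).
      rewrite (_ : e + n.+1%:Z + t = e + n%:Z) ?next_letter; last by lia.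
      by congr (x _); lia.
    rewrite (_ : e + n.+1%:Z + t = e + n%:Z + (t + 1)) ?ag; try lia.
    by congr (x _); lia.
  split=> //; have [small|big] := ltP n%:Z q.
    by apply: no; rewrite /e; have := ltn_ord k2; lia.
  have [|ag' nsp] := IH (n - `|q|)%N; first by rewrite /q; lia.
  rewrite (_ : e + (n - `|q|)%N%:Z = e + n%:Z - q) in ag' nsp; last by rewrite /q; lia.
  rewrite subrK in ag'; case=> e' [ag'' ne]; apply: nsp.
  have [eqx|nex] := pselect (x (e + n%:Z - q) = x (e + n%:Z)).
    exists e'; split; last by rewrite eqx.
    by move=> t t0 t1; rewrite ag' // ag''.
  by exists (e + n%:Z).
apply: (aper q e); first by rewrite /q; lia.
move=> t te; have [ag nsp] := main `|t - e|%N.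
rewrite (_ : e + `|t - e|%N%:Z = t) in ag nsp; last by lia.
by apply: contrapT => ne; apply: nsp; exists (t + q); split=> // /esym.
Qed.

(** Slide a frame of length 2M + l over the windows of radius M around the
    points of S: two of these windows seen at different offsets below l in one
    frame would put two points of S at distance less than l. So the l frames
    around each window are distinct words. *)
Lemma covered_windows (S : set int) (M l n : nat) :
  (0 < l)%N -> local x M S ->
  (forall s s', S s -> S s' -> s < s' -> s + l%:Z <= s') ->
  (#|words (M + M + l)| <= n * l)%N ->
  covered [set u | exists2 s, S s & u = window x (s - M%:Z) (M + M)] n.
Proof.
move=> l0 locS sep card.
pose V := [set u : (M + M).-tuple A |
  `[< exists2 s, S s & u = window_tuple (s - M%:Z) (M + M) >]]%SET.
have ex u : u \in V -> {s | S s & u = window_tuple (s - M%:Z) (M + M)}.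
  by rewrite inE => /asboolP h; apply: cid2.
pose c u := if boolP (u \in V) is AltTrue h then s2val (ex u h) else 0.
have cP u : u \in V -> S (c u) /\ u = window_tuple (c u - M%:Z) (M + M).
  move=> uV; rewrite /c; case: {-}_ / boolP => [h|]; last by rewrite uV.
  by case: (ex u h).
pose f (p : (M + M).-tuple A * 'I_l) :=
  window_tuple (c p.1 - M%:Z - p.2%:Z) (M + M + l).
have inj : {in finset.setX V [set: 'I_l]%SET &, injective f}.
  move=> [u k] [v k']; rewrite !finset.in_setX !finset.in_setT !andbT => uV vV.
  move=> /(congr1 val) /= /window_eqP eqw.
  have [Su uE] := cP u uV; have [Sv vE] := cP v vV.
  have Sv' : S (c v + (k%:Z - k'%:Z)).
    apply: locS Su => t t0 t1.
    have := eqw (M%:Z + k%:Z + t).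
    rewrite (_ : c u - M%:Z - k%:Z + (M%:Z + k%:Z + t) = c u + t); last by lia.
    rewrite (_ : c v - M%:Z - k'%:Z + (M%:Z + k%:Z + t) = c v + (k%:Z - k'%:Z) + t); last by lia.
    by apply; have := ltn_ord k; lia.
  have kk : k = k' :> nat.
    have := ltn_ord k; have := ltn_ord k'.
    have := sep _ _ Sv Sv'; have := sep _ _ Sv' Sv; lia.
  congr (_, _); last exact: val_inj.
  rewrite uE vE; apply: val_inj; apply/window_eqP => t t0 t1.
  have := eqw (k%:Z + t); rewrite -kk !addrA !subrK; apply; have := ltn_ord k; lia.
have : (#|V| * l <= n * l)%N.
  rewrite -{1}[l]card_ord -finset.cardsT -cardsX -(card_in_imset inj).
  apply: leq_trans card; apply: subset_leq_card.
  apply/fintype.subsetP => _ /imsetP[p _ ->].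
  by apply/in_words; eexists.
rewrite leq_pmul2r // => Vn.
exists (map val (enum V)); first by rewrite size_map -cardE.
move=> u [s Ss ->]; apply/mapP; exists (window_tuple (s - M%:Z) (M + M)) => //.
by rewrite mem_enum inE; apply/asboolP; exists s.
Qed.

End Counting.

(** * Nested levels of chains *)

Section Levels.
Variables (A : finType) (x : fullshift A).
Implicit Types (i j s y z t : int) (C : set int).

Lemma syndetic_le g g' C : (g <= g')%N -> syndetic g C -> syndetic g' C.
Proof. by move=> le syn y; have [c [Cc c1 c2]] := syn y; exists c; split=> //; lia. Qed.

Lemma level_setT D : (0 < D)%N -> level x D [set: int] 1.
Proof.
move=> D0; split=> //.
  by move=> y; exists y; split=> //; lia.
by move=> c c' c'' [_ _ lt _] _ lt1; lia.
Qed.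

(** The new scale l' is a fixed multiple of l, so large that the radius and the
    gaps of the settled points are small compared to it. The length m lies between
    4 l' and 8 l', whence the radius 9 l' of the new level; there are at most 2c
    right special words of this length, and x has at most 8 c l' words of length m,
    whence the bound on the gaps. *)
Lemma next_level c C l : (0 < l)%N ->
  (forall k, (0 < k)%N -> (#|words x k| <= c * k)%N) ->
  (forall q y, 0 < q -> ~ forall t, y <= t -> x (t + q) = x t) ->
  let D := (12 * c).+1 in
  level x D C l ->
  exists C', C' `<=` settled ((D + 4) * l) l C /\ level x D C' ((5 * D + 36) * l).
Proof.
move=> l0 lin aper D [locC synC _]; set h := ((D + 4) * l)%N.
set l' := ((5 * D + 36) * l)%N.
have l'0 : (0 < 4 * l')%N by rewrite !muln_gt0 l0 addn_gt0 orbT.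
have [m [lm ml few]] := slow_growth l'0 lin.
have m0 : (0 < m)%N by apply: leq_trans lm.
have locQ := local_settled (h := h) (l := l) locC.
have synQ := syndetic_settled h l synC.
have [|C' [sub locC' synC' chC']] := select_chains (l := l') locQ synQ
  (covered_special x m) (syndetic_special m aper).
  by rewrite /l' /h in lm *; nia.
exists C'; split=> //; split=> //.
  by apply: local_le locC'; lia.
apply: syndetic_le synC'.
have := lin m m0; set w := #|_| => wm.
have wl : (w <= 8 * (c * l'))%N by nia.
have fl : (2 * ((#|words x m.+1| - w) * l') <= 4 * (c * l'))%N by nia.
have El : (9 * l + l + h + (D * l + h + h) <= l')%N by rewrite /l' /h; nia.
have DE : (D * l' = l' + 12 * (c * l'))%N by rewrite /D; lia.
by lia.
Qed.

Lemma nested_levels c :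
  (forall k, (0 < k)%N -> (#|words x k| <= c * k)%N) ->
  (forall q y, 0 < q -> ~ forall t, y <= t -> x (t + q) = x t) ->
  let D := (12 * c).+1 in let K := (5 * D + 36)%N in
  exists Cs : nat -> set int, forall n, level x D (Cs n) (K ^ n) /\
    Cs n.+1 `<=` settled ((D + 4) * K ^ n) (K ^ n) (Cs n).
Proof.
move=> lin aper D K.
have step n (C : {C | level x D C (K ^ n)}) :
    {C' : {C' | level x D C' (K ^ n.+1)} |
      sval C' `<=` settled ((D + 4) * K ^ n) (K ^ n) (sval C)}.
  apply: cid; case: C => C lev.
  have [|C' [sub lev']] := next_level (l := K ^ n) _ lin aper lev.
    by rewrite expn_gt0.
  rewrite -expnS in lev'.
  by exists (exist _ C' lev').
pose base : {C | level x D C (K ^ 0)} := exist _ _ (level_setT (ltn0Sn (12 * c))).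
pose Cs := nat_rect (fun n => {C | level x D C (K ^ n)}) base
  (fun n P => sval (step n P)).
exists (fun n => sval (Cs n)) => n; split; first exact: (svalP (Cs n)).
exact: (svalP (step n (Cs n))).
Qed.

(** * Cutting a point into pieces *)

Inductive tiled (P : int -> int -> Prop) : int -> int -> Prop :=
| tiled1 i j : P i j -> tiled P i j
| tiled_cons i k j : P i k -> tiled P k j -> tiled P i j.

Lemma tiled_cat P i k j : tiled P i k -> tiled P k j -> tiled P i j.
Proof.
elim=> [i' k' Pik tkj | i' k' l Pik _ IH tkj]; first exact: tiled_cons Pik tkj.
by apply: tiled_cons Pik _; apply: IH.
Qed.

(** A piece inside a chain may start at any of its points, but it is a power of a
    word that depends on the chain only. The left end of a last piece is found by
    looking back from the right end by a fixed distance, so that the piece is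
    determined by the letters around the start of a chain. *)
Definition chain_piece l C i j : Prop := exists s (p k : nat),
  [/\ starts l C s, successive C s (s + p%:Z), (p < l)%N, (0 < k)%N &
      j = i + (k * p)%:Z /\ window x i (k * p) = word_pow (window x s p) k].

Definition whole_piece l C i j : Prop := successive (starts l C) i j.

Definition last_piece (g l : nat) C i j : Prop :=
  [/\ starts l C j, C i, i + g%:Z <= j & forall z, C z -> z + g%:Z <= j -> z <= i].

Definition piece (g h l : nat) C i j : Prop :=
  [/\ C i /\ C j, i + l%:Z <= j, j <= i + h%:Z &
      [\/ chain_piece l C i j, whole_piece l C i j | last_piece g l C i j]].

Section Tiling.
Variables (D : nat) (C : set int) (l : nat).
Hypothesis l0 : (0 < l)%N.
Hypothesis lev : level x D C l.

(** A point that is not a start is less than l after its predecessor, so the gap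
    is the same as the preceding one. *)
Lemma chain_structure s c : starts l C s -> C c -> s <= c ->
  (forall z, s < z -> z <= c -> ~ starts l C z) ->
  c = s \/ exists p a : nat,
    [/\ (0 < p)%N, (p < l)%N, successive C s (s + p%:Z), c = s + (a * p)%:Z &
      forall b, (b < a)%N -> successive C (s + (b * p)%:Z) (s + (b.+1 * p)%:Z) /\
        agree x s (s + (b * p)%:Z) 0 p].
Proof.
have [n] := ubnP `|c - s|; elim: n c => // n IH c cn Ss Cc sc no.
have [->|ne] := eqVneq c s; [by left | right].
have [|c1 [c1c Cc1 max]] := @int_greatest C (c - 1).
  by exists s; [lia | case: Ss].
have sc1 : s <= c1.
  by rewrite leNgt; apply/negP => lt; apply: (max s) => //; [lia | case: Ss].
have nx : successive C c1 c.
  by split=> //; [lia | move=> z z1 z2; apply: max; lia].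
have short : c - c1 < l%:Z.
  rewrite ltNge; apply/negP => ge; apply: (no c); [lia | lia |].
  split=> // z Cz zc; have : z <= c1; last by lia.
  by rewrite leNgt; apply/negP => lt; apply: (max z) => //; lia.
have [c1s|ne1] := eqVneq c1 s.
  exists `|c - s|%N, 1%N; rewrite c1s in nx short *.
  have cE : c = s + `|c - s|%N%:Z by lia.
  split; [lia | lia | by rewrite -cE | by rewrite mul1n |].
  by case=> // _; rewrite mul0n mul1n addr0 -cE; split.
have [|||||c1s|[p [a [p0 pl nxs c1E chain]]]] := IH c1.
- by lia.
- by [].
- by [].
- by [].
- by move=> z z1 z2; apply: no; lia.
- by rewrite c1s eqxx in ne1.
have a0 : (0 < a)%N.
  by case: (a) c1E => // c1E; move: ne1; rewrite c1E mul0n addr0 eqxx.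
have [nx1 ag1] : successive C (s + (a.-1 * p)%:Z) c1 /\ agree x s (s + (a.-1 * p)%:Z) 0 p.
  by have := chain a.-1; rewrite prednK // -c1E; apply.
have gapE : c1 - (s + (a.-1 * p)%:Z) = p%:Z.
  by rewrite c1E -[in X in X - _](prednK a0) mulSn; lia.
have [eqgap ag] : c1 - (s + (a.-1 * p)%:Z) = c - c1 /\
    agree x (s + (a.-1 * p)%:Z) c1 0 `|(c1 - (s + (a.-1 * p)%:Z))%R|.
  by apply: (level_chain lev) nx1 nx _ short; rewrite gapE; lia.
rewrite gapE in eqgap ag.
have cE : c = s + (a.+1 * p)%:Z by rewrite mulSn; lia.
exists p, a.+1; split=> // b; rewrite ltnS leq_eqVlt => /orP[/eqP->|/chain //].
rewrite -cE -c1E; split=> // t t0 t1.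
by rewrite ag1 // ag.
Qed.

Lemma chain_power s (p a b k : nat) :
  (forall b', (b' < a)%N -> agree x s (s + (b' * p)%:Z) 0 p) ->
  (b + k <= a)%N ->
  window x (s + (b * p)%:Z) (k * p) = word_pow (window x s p) k.
Proof.
move=> ag; elim: k b => [|k IH] b bk; first by rewrite mul0n.
rewrite mulSn window_cat word_powS; congr (_ ++ _).
  by apply/esym/window_eqP; apply: ag; lia.
rewrite (_ : s + (b * p)%:Z + p%:Z = s + (b.+1 * p)%:Z); last by rewrite mulSn; lia.
by apply: IH; lia.
Qed.

Variables (g h : nat).
Hypothesis gD : g = (D * l).+2.
Hypothesis gh : (g + 2 * l <= h)%N.
Hypothesis lg : (l <= g)%N.

(** Cut off the least multiple of the period that exceeds l, as long as what
    remains to be cut is longer than 3 l. *)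
Lemma tiled_chain s (p a b k : nat) :
  starts l C s -> successive C s (s + p%:Z) -> (0 < p)%N -> (p < l)%N ->
  (forall b', (b' <= a)%N -> C (s + (b' * p)%:Z)) ->
  (forall b', (b' < a)%N -> agree x s (s + (b' * p)%:Z) 0 p) ->
  (b + k <= a)%N -> (l <= k * p)%N ->
  tiled (piece g h l C) (s + (b * p)%:Z) (s + ((b + k) * p)%:Z).
Proof.
move=> Ss nx p0 pl inC ag; have [n] := ubnP k.
elim: n b k => // n IH b k kn bk lk.
have chp k' : (0 < k')%N -> (k' <= k)%N ->
    chain_piece l C (s + (b * p)%:Z) (s + ((b + k') * p)%:Z).
  move=> k'0 k'k; exists s, p, k'; split=> //; split; first by rewrite mulnDl; lia.
  by apply: (chain_power (a := a)) => //; lia.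
have k0 : (0 < k)%N by case: (k) lk => //; lia.
have [small|big] := leqP (k * p) (3 * l).
  apply: tiled1; split;
    [by split; apply: inC; lia | rewrite mulnDl; lia | rewrite mulnDl; lia |].
  by constructor 1; apply: chp.
pose k1 := (l %/ p).+1.
have k10 : (0 < k1)%N by [].
have k1p : (l < k1 * p)%N by rewrite ltn_ceil.
have k1l : (k1 * p < 2 * l)%N.
  by rewrite /k1 mulSn; have := leq_trunc_div l p; lia.
have k1k : (k1 < k)%N by rewrite -(ltn_pmul2r p0); lia.
have kE : k = (k1 + (k - k1))%N by lia.
have kpE : (k * p = k1 * p + (k - k1) * p)%N by rewrite {1}kE mulnDl.
apply: (@tiled_cons _ _ (s + ((b + k1) * p)%:Z)).
  split; [by split; apply: inC; lia | rewrite mulnDl; lia | rewrite mulnDl; lia |].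
  by constructor 1; apply: chp; lia.
rewrite (_ : (b + k)%N = (b + k1 + (k - k1))%N); last by lia.
by apply: IH; move: kpE k1l big bk kn k1k k10; clearbody k1; lia.
Qed.

Lemma tiled_same_chain s i j : starts l C s -> C i -> C j -> s <= i ->
  i + l%:Z <= j -> (forall z, s < z -> z <= j -> ~ starts l C z) ->
  tiled (piece g h l C) i j.
Proof.
move=> Ss Ci Cj si ij no.
have [js|[p [a [p0 pl nx jE chain]]]] := chain_structure Ss Cj (ltac:(lia)) no.
  by lia.
have ag b : (b < a)%N -> agree x s (s + (b * p)%:Z) 0 p by move=> /chain[].
have [b iE] : exists b, i = s + (b * p)%:Z.
  have [|->|[p' [b [_ _ nx' iE _]]]] := chain_structure Ss Ci si.
  - by move=> z z1 z2; apply: no; lia.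
  - by exists 0%N; rewrite mul0n addr0.
  have := successive_fun nx nx' => /addrI/eqP; rewrite eqz_nat => /eqP pp.
  by exists b; rewrite iE pp.
have ba : (b < a)%N by rewrite -(ltn_pmul2r p0); lia.
rewrite iE jE -(subnKC (ltnW ba)).
apply: (tiled_chain (a := a) Ss nx p0 pl) => //; [|lia|].
  move=> b'; rewrite leq_eqVlt => /orP[/eqP->|/chain[[]] //].
  by rewrite -jE.
by rewrite mulnBl; lia.
Qed.

Hypothesis starts_left : forall y, exists2 s, s <= y & starts l C s.

Lemma last_start y : exists s, [/\ s <= y, starts l C s &
  forall z, z <= y -> s < z -> ~ starts l C z].
Proof. exact: int_greatest (starts_left y). Qed.

(** The last piece before a chain start e is chosen by looking back from e
    only; its left end lies on the chain of i because the chain reaches closer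
    to e than the gap bound. *)
Lemma tiled_to_start i e : settled h l C i -> successive (starts l C) i e \/
    (~ starts l C i /\ starts l C e /\ i < e /\
      forall z, i < z -> z < e -> ~ starts l C z) ->
  tiled (piece g h l C) i e.
Proof.
move=> [Ci st] nx.
have [Se ie no] : [/\ starts l C e, i < e & forall z, i < z -> z < e -> ~ starts l C z].
  by case: nx => [[]|[_ [? []]]].
have [close|far] := leP e (i + h%:Z).
  have nxi : successive (starts l C) i e.
    by case: nx => // -[nSi _]; case: st => // /(_ e Se); lia.
  apply: tiled1; split=> //; last by constructor 2.
    by split=> //; case: Se.
  by case: Se => _; apply.
have [|k [ke Ck max]] := @int_greatest C (e - g%:Z); first by exists i => //; lia.
have ik : i <= k by rewrite leNgt; apply/negP => lt; apply: (max i) => //; lia.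
have ek : e < k + g%:Z + l%:Z.
  have [c [Cc c1 c2]] := level_syndetic lev (e - 1 - (D * l)%:Z).
  have [|z [kz Cz min]] := @int_least C (k + 1).
    exists c => //; rewrite leNgt; apply/negP => lt; lia.
  have zc : z <= c.
    rewrite leNgt; apply/negP => lt; apply: (min c) => //.
    by rewrite leNgt; apply/negP => lt'; lia.
  have ze : e - g%:Z < z.
    by rewrite ltNge; apply/negP => le; apply: (max z) => //; lia.
  have [w [Cw wz zw]] : exists w, [/\ C w, w < z & z < w + l%:Z].
    apply: contrapT => nw; apply: (no z); [lia | lia |]; split=> // w Cw wz.
    by rewrite leNgt; apply/negP => lt; apply: nw; exists w.
  have : w <= k; last by lia.
  by rewrite leNgt; apply/negP => lt; apply: (min w) => //; lia.
have [s [si Ss nos]] := last_start i.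
apply: (@tiled_cat _ _ k).
  apply: (tiled_same_chain Ss) => //; first by lia.
  move=> z z1 z2; have [zi|iz] := leP z i; first exact: nos.
  by apply: no; lia.
apply: tiled1; split; [by split=> //; case: Se | by case: Se => _; apply => //; lia | lia |].
constructor 3; split=> //; first by lia.
move=> z Cz ze; rewrite leNgt; apply/negP => lt; apply: (max z) => //; lia.
Qed.

(** Cut at all chain starts between i and j. Those ends that lie inside chains are
    far from the ends of the chains, so that all parts are long enough. *)
Lemma tiled_settled i j : settled h l C i -> settled h l C j -> i + l%:Z <= j ->
  tiled (piece g h l C) i j.
Proof.
have [n] := ubnP `|j - i|; elim: n i => // n IH i ijn Qi Qj ij.
have [[e1 [ie1 e1j Se1]]|no] := pselect (exists e, [/\ i < e, e <= j & starts l C e]).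
  have [|e [ie Se min]] := @int_least (starts l C) (i + 1); first by exists e1 => //; lia.
  have ej : e <= j.
    by rewrite leNgt; apply/negP => lt; apply: (min e1) => //; lia.
  have ti : tiled (piece g h l C) i e.
    apply: tiled_to_start => //.
    have mid z : i < z -> z < e -> ~ starts l C z by move=> z1; apply: min; lia.
    have [Si|nSi] := pselect (starts l C i); [left | right].
      by split=> //; lia.
    by do ![split=> //]; lia.
  have [<- //|ne] := eqVneq e j.
  apply: (tiled_cat ti); apply: IH => //; [lia | by split; [case: Se | left] |].
  case: Qj => Cj [[_ first]|far]; first by apply: first; [case: Se | lia].
  by have := far e Se; lia.
have [s [si Ss nos]] := last_start i.
apply: (tiled_same_chain Ss) => //; [by case: Qi | by case: Qj |].
move=> z z1 z2 Sz; have [zi|iz] := leP z i; first exact: (nos z).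
by apply: no; exists z.
Qed.

End Tiling.

(** A chain without a first point would make x periodic to the left. *)
Lemma no_left_chain D C l : (0 < l)%N -> level x D C l ->
  (forall q y, 0 < q -> ~ forall t, t <= y -> x (t - q) = x t) ->
  forall y, exists2 s, s <= y & starts l C s.
Proof.
move=> l0 lev aper y; apply: contrapT => no.
have pre c : C c -> c <= y -> exists c', successive C c' c /\ c - c' < l%:Z.
  move=> Cc cy.
  have [w [Cw wc cw]] : exists w, [/\ C w, w < c & c < w + l%:Z].
    apply: contrapT => nw; apply: no; exists c => //; split=> // w Cw wc.
    by rewrite leNgt; apply/negP => lt; apply: nw; exists w.
  have [|k [kc Ck max]] := @int_greatest C (c - 1); first by exists w => //; lia.
  have wk : w <= k by rewrite leNgt; apply/negP => lt; apply: (max w) => //; lia.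
  exists k; split; last by lia.
  by split=> //; [lia | move=> z z1 z2; apply: max; lia].
have [c [Cc c1 c2]] := level_syndetic lev (y - (D * l)%:Z).
have cy : c <= y by lia.
have [c' [nx lt]] := pre c Cc cy.
pose p := `|c - c'|%N.
have p0 : (0 < p)%N by case: nx => _ _ + _; rewrite /p; lia.
have pl : p%:Z < l%:Z by case: nx => _ _ + _; rewrite /p; lia.
pose d n := c - (n * p)%:Z.
have dS n : d n - d n.+1 = p%:Z by rewrite /d mulSn; lia.
have chain n : successive C (d n.+1) (d n).
  elim: n => [|n nxn].
    by rewrite /d mul0n mul1n subr0 (_ : c - p%:Z = c') // /p; case: nx; lia.
  have [||c'' [nx' lt']] := pre (d n.+1); [by case: nxn | by rewrite /d; lia |].
  have [||eqgap _] := level_chain lev nx' nxn; [by [] | by rewrite dS |].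
  by rewrite (_ : d n.+2 = c'') //; have := dS n; have := dS n.+1; lia.
apply: (aper p%:Z (c - 1)); first by lia.
move=> t tc; pose n := (`|(c - 1 - t)%R| %/ p)%N.
have nE := divn_eq `|(c - 1 - t)%R| p; have nlt := ltn_pmod `|(c - 1 - t)%R| p0.
rewrite -/n in nE.
have [||_ ag] := level_chain lev (chain n.+1) (chain n); [by rewrite dS | by rewrite dS |].
have dSn := dS n; have dSSn := dS n.+1.
have tn : d n.+1 <= t < d n by rewrite /d mulSn; apply/andP; split; lia.
have := ag (t - d n.+1).
rewrite (_ : d n.+2 + (t - d n.+1) = t - p%:Z); last by lia.
rewrite (_ : d n.+1 + (t - d n.+1) = t); last by lia.
by apply; lia.
Qed.

End Levels.

(** * Few roots *)

Section Roots.
Variables (A : finType) (x : fullshift A).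
Implicit Types (i j s y z t : int) (C : set int).

(** A piece inside a chain is a power, whose root is seen from the start of the
    chain; the other pieces are seen from one of their ends. That end is a chain
    start in each case. *)
Lemma covered_piece_roots C (l g h n : nat) : local x (9 * l) C ->
  let M := (9 * l + l + h)%N in
  covered [set u | exists2 s, starts l C s & u = window x (s - M%:Z) (M + M)] n ->
  covered [set u | exists i j, piece x g h l C i j /\
                     u = root_word (window x i `|(j - i)%R|)] (n + n + n).
Proof.
move=> loc M cov; have locS := local_starts (l := l) loc.
pose inside u := exists s (p : nat), [/\ starts l C s, successive C s (s + p%:Z),
  (p < l)%N & u = root_word (window x s p)].
pose whole u := exists i j, [/\ successive (starts l C) i j, j <= i + h%:Z &
  u = root_word (window x i `|(j - i)%R|)].
pose last u := exists i j, [/\ last_piece g l C i j, j <= i + h%:Z, i <= j &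
  u = root_word (window x i `|(j - i)%R|)].
have agreeP s s' : window x (s - M%:Z) (M + M) = window x (s' - M%:Z) (M + M) ->
  agree x s s' M M by move/agree_window.
have cov_inside : covered inside n.
  apply: (covered_rel (P := fun w u => exists s (p : nat), [/\ starts l C s /\
      w = window x (s - M%:Z) (M + M), successive C s (s + p%:Z),
      (p < l)%N & u = root_word (window x s p)]) cov).
    move=> u [s [p [Ss nx pl uE]]]; exists (window x (s - M%:Z) (M + M)).
      by exists s.
    by exists s, p.
  move=> w u u' _ _ [s [p [[Ss ->] nx pl ->]]] [s' [p' [[Ss' /agreeP ag] nx' pl' ->]]].
  have le s1 s2 (p1 p2 : nat) : agree x s1 s2 M M -> successive C s1 (s1 + p1%:Z) ->
      successive C s2 (s2 + p2%:Z) -> (p1 < l)%N -> (p2 <= p1)%N.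
    move=> ag12 [_ C1 lt1 _] [_ _ _ no] p1l; rewrite leqNgt; apply/negP => lt.
    apply: (no (s2 + p1%:Z)); [lia | lia |].
    by apply: (local_shift loc ag12) C1; rewrite /M; lia.
  have -> : p = p'.
    apply/eqP; rewrite eqn_leq (le _ _ _ _ ag nx nx' pl).
    by rewrite (le _ _ _ _ (agree_sym ag) nx' nx pl').
  by congr root_word; apply/window_eqP => t t0 t1; apply: ag; rewrite /M; lia.
have cov_whole : covered whole n.
  apply: (covered_rel (P := fun w u => exists i j,
     [/\ w = window x (i - M%:Z) (M + M), successive (starts l C) i j, j <= i + h%:Z &
      u = root_word (window x i `|(j - i)%R|)]) cov).
    move=> u [i [j [nx ji uE]]]; exists (window x (i - M%:Z) (M + M)).
      by exists i => //; case: nx.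
    by exists i, j.
  move=> w u u' _ _ [i [j [-> nx ji ->]]] [i' [j' [/agreeP ag nx' ji' ->]]].
  have le i1 i2 j1 j2 : agree x i1 i2 M M -> successive (starts l C) i1 j1 ->
      successive (starts l C) i2 j2 -> j1 <= i1 + h%:Z -> j2 - i2 <= j1 - i1.
    move=> ag12 [_ S1 lt1 _] [_ _ _ no] j1h; rewrite leNgt; apply/negP => lt.
    apply: (no (i2 + (j1 - i1))); [lia | lia |].
    apply: (local_shift locS ag12); [rewrite /M; lia | rewrite /M; lia |].
    by rewrite addrC subrK.
  have -> : j - i = j' - i'.
    apply/eqP; rewrite eq_le (le _ _ _ _ (agree_sym ag) nx' nx ji').
    by rewrite (le _ _ _ _ ag nx nx' ji).
  congr root_word; apply/window_eqP => t t0 t1; apply: ag; rewrite /M; try lia.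
  by case: nx' => _ _ lt _; lia.
have cov_last : covered last n.
  apply: (covered_rel (P := fun w u => exists i j,
     [/\ w = window x (j - M%:Z) (M + M), last_piece g l C i j, i <= j <= i + h%:Z &
      u = root_word (window x i `|(j - i)%R|)]) cov).
    move=> u [i [j [la ji ij uE]]]; exists (window x (j - M%:Z) (M + M)).
      by exists j; case: la.
    by exists i, j; split=> //; rewrite ij ji.
  move=> w u u' _ _ [i [j [-> la /andP[ij ji] ->]]].
  move=> [i' [j' [/agreeP ag la' /andP[ij' ji'] ->]]].
  have le i1 i2 j1 j2 : agree x j1 j2 M M -> last_piece g l C i1 j1 ->
      last_piece g l C i2 j2 -> i1 <= j1 -> j1 <= i1 + h%:Z -> j2 - i2 <= j1 - i1.
    move=> ag12 [_ C1 g1 _] [_ _ _ max] ij1 ij2.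
    have := max (j2 + (i1 - j1)); suff: C (j2 + (i1 - j1)) by move=> c /(_ c); lia.
    apply: (local_shift loc ag12); [rewrite /M; lia | rewrite /M; lia |].
    by rewrite addrC subrK.
  have E : j - i = j' - i'.
    apply/eqP; rewrite eq_le (le _ _ _ _ (agree_sym ag) la' la) //.
    by rewrite (le _ _ _ _ ag la la').
  rewrite E; congr root_word; apply/window_eqP => t t0 t1.
  have := ag (t - (j - i)); rewrite (_ : j + (t - (j - i)) = i + t); last by lia.
  rewrite (_ : j' + (t - (j - i)) = i' + t); last by lia.
  by apply; rewrite /M; lia.
apply: covered_le (coveredU (coveredU cov_inside cov_whole) cov_last) _ _ => //.
move=> u [i [j [[_ ij ji kind] ->]]].
case: kind => [[s [p [k [Ss nx pl k0 [jE wE]]]]]|nx|la].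
- left; left; exists s, p; split=> //.
  rewrite (_ : `|(j - i)%R|%N = (k * p)%N); last by rewrite jE; lia.
  by rewrite wE root_word_pow.
- by left; right; exists i, j.
- by right; exists i, j; split=> //; lia.
Qed.

(** * Systems of words *)

(** The set W n stands for the values of the composed morphism of level n+1 of an
    S-adic sequence; the letters are forgotten. *)
Record word_system (d : nat) (W : nat -> set (seq A)) : Prop := WordSystem {
  ws_nonempty : forall n, W n !=set0;
  ws_window : forall n w, W n w -> exists i, window x i (size w) = w;
  ws_balanced : forall n w w', W n w -> W n w' -> (size w <= d * size w')%N;
  ws_long : forall n w, W n w -> (n < size w)%N;
  ws_first : forall w, W 0%N w -> (size w <= d)%N;
  ws_roots : forall n, covered [set root_word w | w in W n] d;
  ws_split : forall n w, W n.+1 w -> exists v : seq (seq A),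
    [/\ forall u, u \in v -> W n u, (size v <= d)%N & w = flatten v] }.

Lemma tiled_flatten P l i j : (forall i j, P i j -> i + l%:Z <= j) -> tiled P i j ->
  i <= j /\ exists v : seq (seq A), [/\
    forall u, u \in v -> exists i j, P i j /\ u = window x i `|(j - i)%R|,
    (size v * l <= `|(j - i)%R|)%N & window x i `|(j - i)%R| = flatten v].
Proof.
move=> Pl; elim=> {i j} [i j Pij | i k j Pik _ [kj [v [vP vs vE]]]].
  have := Pl _ _ Pij => ij; split; first by lia.
  exists [:: window x i `|(j - i)%R|]; split; [|rewrite mul1n; lia|by rewrite /= cats0].
  by move=> u; rewrite inE => /eqP ->; exists i, j.
have := Pl _ _ Pik => ik; split; first by lia.
exists (window x i `|(k - i)%R| :: v); split; [|rewrite /= mulSn; lia|].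
  by move=> u; rewrite inE => /orP[/eqP->|/vP //]; exists i, k.
rewrite /= -vE (_ : `|(j - i)%R|%N = (`|(k - i)%R| + `|(j - k)%R|)%N); last by lia.
by rewrite window_cat (_ : i + _ = k) //; lia.
Qed.

(** The words of level n are the pieces of the n-th set of cuts. The ends of a
    piece of level n+1 are settled points of level n, so that it is tiled by
    pieces of level n; their lengths are comparable to K^n. *)
Lemma aperiodic_word_system (c : nat) :
  (forall k, (0 < k)%N -> (#|words x k| <= c * k)%N) ->
  (forall q y, 0 < q -> ~ forall t, y <= t -> x (t + q) = x t) ->
  (forall q y, 0 < q -> ~ forall t, t <= y -> x (t - q) = x t) ->
  exists d W, word_system d W.
Proof.
move=> lin aper aperl; have [Cs CsP] := nested_levels lin aper.
set D := (12 * c).+1 in CsP; set K := (5 * D + 36)%N in CsP.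
pose l n := (K ^ n)%N.
have l0 n : (0 < l n)%N by rewrite expn_gt0.
have lS n : l n.+1 = (K * l n)%N by rewrite /l expnS.
have K2 : (1 < K)%N by rewrite /K; lia.
have lev n : level x D (Cs n) (l n) by have [] := CsP n.
have sub n : Cs n.+1 `<=` settled ((D + 4) * l n) (l n) (Cs n) by have [] := CsP n.
pose P n := piece x (D * l n).+2 ((D + 4) * l n) (l n) (Cs n).
pose W n := [set w | exists i j, P n i j /\ w = window x i `|(j - i)%R|].
pose d := ((D + 4) * K + (c * (2 * D + 29) + c * (2 * D + 29) + c * (2 * D + 29)))%N.
have Pl n i j : P n i j -> i + (l n)%:Z <= j by case.
have tile n i j : Cs n.+1 i -> Cs n.+1 j -> i + (l n)%:Z <= j -> tiled (P n) i j.
  move=> Ci Cj; apply: (tiled_settled (D := D)) => //.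
  - by rewrite mulnDl; have := l0 n; lia.
  - by rewrite leqW // leqW // leq_pmull.
  - exact: no_left_chain (lev n) aperl.
  - exact: sub.
  - exact: sub.
have dD : (D + 4 <= d)%N.
  by rewrite /d; apply: leq_trans (leq_addr _ _); rewrite leq_pmulr //; lia.
have Wsize n w : W n w -> (l n <= size w)%N /\ (size w <= (D + 4) * l n)%N.
  by move=> [i [j [[_ ij ji _] ->]]]; rewrite size_mkseq; split; lia.
exists d, W; split.
- move=> n; have [i [Ci _ _]] := level_syndetic (lev n.+1) 0.
  have [j [Cj ij _]] := level_syndetic (lev n.+1) (i + (l n)%:Z).
  case: (tile n i j Ci Cj ij) => [i' j' Pij|i' k j' Pik _].
    by exists (window x i' `|(j' - i')%R|); exists i', j'.
  by exists (window x i' `|(k - i')%R|); exists i', k.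
- by move=> n w [i [j [_ ->]]]; exists i; rewrite size_mkseq.
- move=> n w w' /Wsize[_ w2] /Wsize[w1 _].
  by apply: leq_trans w2 _; apply: leq_mul.
- move=> n w /Wsize[w1 _]; apply: leq_trans w1.
  exact: ltn_expl.
- move=> w /Wsize[_]; rewrite /l expn0 muln1 => w2; exact: leq_trans w2 dD.
- move=> n; have loc := level_local (lev n).
  have := covered_windows (x := x) (S := starts (l n) (Cs n))
    (M := (9 * l n + l n + (D + 4) * l n)%N) (l := l n) (n := (c * (2 * D + 29))%N) (l0 n).
  move=> /(_ (local_le _ (local_starts loc)) _ _)[].
  - by lia.
  - by move=> s s' [Cs1 _] [_ first] lt; apply: first.
  - apply: leq_trans (lin _ _) _; first by have := l0 n; lia.
    by lia.
  move=> L Ln LP.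
  have cov := covered_piece_roots (D * l n).+2 loc (ex_intro2 _ _ L Ln LP).
  apply: covered_le cov _ _; last by rewrite /d leq_addl.
  by move=> _ [w [i [j [Pij ->]]] <-]; exists i, j.
- move=> n w [i [j [Pij ->]]].
  have [[Ci Cj] ij _ _] := Pij.
  have [|_ [v [vP vs vE]]] := tiled_flatten (Pl n) (tile n i j Ci Cj _).
    by apply: le_trans ij; rewrite lerD2l lez_nat lS leq_pmull //; lia.
  exists v; split=> //.
  have [_] := Wsize n.+1 _ (ex_intro _ i (ex_intro _ j (conj Pij erefl))).
  rewrite size_mkseq lS mulnA => ws.
  apply: (@leq_trans ((D + 4) * K)); last exact: leq_addr.
  by rewrite -(leq_pmul2r (l0 n)); apply: leq_trans vs ws.
Qed.

(** One word at each level is enough, each being the square of the preceding. *)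
Lemma periodic_word_system (q : nat) : (0 < q)%N ->
  (forall t, x (t + q%:Z) = x t) -> exists d W, word_system d W.
Proof.
move=> q0 per; pose W n := [set window x 0 (2 ^ n * q)].
have per2 n t : x (t + (2 ^ n * q)%:Z) = x t.
  elim: n t => [|n IH] t; first by rewrite expn0 mul1n per.
  by rewrite expnS -mulnA mul2n -addnn PoszD addrA !IH.
exists (2 + q)%N, W; split.
- by move=> n; eexists; reflexivity.
- by move=> n w ->; exists 0; rewrite size_mkseq.
- by move=> n w w' -> ->; rewrite leq_pmull // addn_gt0.
- move=> n w ->; rewrite size_mkseq; apply: (@leq_trans (2 ^ n)); first exact: ltn_expl.
  by rewrite leq_pmulr.
- by move=> w ->; rewrite size_mkseq expn0 mul1n leq_addl.
- move=> n; exists [:: root_word (window x 0 (2 ^ n * q))] => //=.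
  by move=> _ [w -> <-]; rewrite inE.
- move=> n w ->; exists (nseq 2 (window x 0 (2 ^ n * q))); split.
  + by move=> u; rewrite mem_nseq => /andP[_ /eqP].
  + by rewrite size_nseq leq_addr.
  rewrite expnS -mulnA mul2n -addnn window_cat /= cats0; congr (_ ++ _).
  by apply/window_eqP => t t0 t1; rewrite add0r addrC per2 add0r.
Qed.

End Roots.

Section Realization.
Variables (A : finType) (x : fullshift A).

Lemma bounded_words N : exists L : seq (seq A), forall w, (size w <= N)%N -> w \in L.
Proof.
exists (flatten [seq [seq val t | t <- enum {: k.-tuple A}] | k <- iota 0 N.+1]).
move=> w wN; apply/flatten_mapP; exists (size w); first by rewrite mem_iota.
by apply/mapP; exists (in_tuple w); rewrite // mem_enum.
Qed.

(** The words of level n are the letters of the alphabet n+1; the splittings are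
    chosen once and for all, and the composed morphisms map each letter to
    itself as a word. *)
Lemma sadic_of_word_system d (W : nat -> set (seq A)) : (0 < #|A|)%N ->
  word_system x d W ->
  exists s : sadic A, (forall n (a : alph s n.+1), W n (sigma_upto a)) /\
    (forall n (a : alph s n.+1), (size (sigma a) <= d)%N).
Proof.
move=> A0 ws.
have fin n : {L : seq (seq A) | forall w, w \in L <-> W n w}.
  apply: cid; have [w0 W0] := ws_nonempty ws n.
  have [L LP] := bounded_words (d * size w0).
  exists [seq w <- L | `[< W n w >]] => w; rewrite mem_filter; split.
    by case/andP => /asboolP.
  by move=> Ww; rewrite LP ?andbT; [apply/asboolP | exact: (ws_balanced ws Ww W0)].
pose L n := sval (fin n).
have LP n w : w \in L n <-> W n w by rewrite /L; case: (fin n).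
pose B n : finType := seq_sub (L n).
have split_word n (a : B n.+1) : {v : seq (B n) | (size v <= d)%N &
    ssval a = flatten (map (@ssval _ (L n)) v)}.
  apply: cid2; have [v [vW vd vE]] := ws_split ws (proj1 (LP _ _) (ssvalP a)).
  have vL : {subset v <= L n} by move=> u /vW /LP.
  have [v' v'E] : exists v' : seq (B n), map (@ssval _ (L n)) v' = v.
    elim: (v) vL => [|u r IH] sub; first by exists [::].
    have [|r' r'E] := IH; first by move=> w wr; apply: sub; rewrite inE wr orbT.
    have uL : u \in L n by apply: sub; rewrite inE eqxx.
    by exists (SeqSub uL :: r'); rewrite /= r'E.
  by exists v'; rewrite ?v'E // -(size_map (@ssval _ (L n))) v'E.
pose mor n : alph_seq A B n.+1 -> seq (alph_seq A B n) :=
  match n return alph_seq A B n.+1 -> seq (alph_seq A B n) with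
  | 0%N => fun a => ssval a
  | m.+1 => fun a => s2val (split_word m a)
  end.
have pos n w : w \in L n -> (0 < size w)%N by move=> /LP /(ws_long ws); apply: leq_trans.
have alph0 n : (0 < #|alph_seq A B n|)%N.
  case: n => [//|n]; have [w /LP wL] := ws_nonempty ws n.
  by apply/card_gt0P; exists (SeqSub wL).
have mor0 n (a : alph_seq A B n.+1) : mor n a != [::].
  case: n a => [|n] a /=; rewrite -size_eq0 -lt0n; first exact: pos (ssvalP a).
  case: (split_word n a) => v _ vE /=; have := pos _ _ (ssvalP a); rewrite vE.
  by case: v {vE}.
pose s := SAdic alph0 mor0.
have uptoE n (a : alph s n.+1) : sigma_upto a = ssval a.
  elim: n a => [|n IH] a.
    by rewrite /= /extend /sigma /=; elim: (ssval a) => //= u r ->.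
  rewrite -[sigma_upto a]/(extend (@sigma_upto A s n.+1) (@sigma A s n.+1 a)).
  rewrite /extend (eq_map IH) /sigma /=.
  by case: (split_word n a).
exists s; split=> [n a|n a]; first by rewrite uptoE; apply/LP/(ssvalP a).
case: n a => [|n] a; rewrite /sigma /=; last by case: (split_word n a).
by apply: (ws_first ws); apply/LP/(ssvalP a).
Qed.

End Realization.

(** * From morphisms to linear complexity *)

Section Seams.
Variables (T : eqType) (a0 : T).

(** The word of length k read p letters to the left of the seam between the
    left-infinite power of r and the right-infinite power of r'. *)
Definition seam_word (r r' : seq T) (k p : nat) : seq T :=
  mkseq (fun j => if (j < p)%N then nth a0 r ((p * size r + j - p) %% size r)
                  else nth a0 r' ((j - p) %% size r')) k.

Lemma seam_wordE (r r' : seq T) (m m' i k : nat) : (0 < size r)%N ->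
  (i <= m * size r)%N -> (k <= m' * size r')%N ->
  take k (drop i (word_pow r m ++ word_pow r' m')) =
  seam_word r r' k (m * size r - i).
Proof.
move=> r0 ir kr'; set p := (_ - _)%N.
have sz : size (take k (drop i (word_pow r m ++ word_pow r' m'))) = k.
  rewrite size_takel // size_drop size_cat !size_word_pow.
  by clear p; lia.
apply: (@eq_from_nth _ a0); rewrite sz ?size_mkseq // => j jk.
rewrite nth_mkseq // nth_take // nth_drop nth_cat size_word_pow.
have -> : (i + j < m * size r)%N = (j < p)%N by rewrite /p; lia.
case: ifP => jp.
  rewrite nth_word_pow; last by move: jp; rewrite /p; lia.
  congr nth; rewrite -(modnMDl p (i + j)) -(modnMDl m (_ + _ - _)).
  by congr (_ %% _)%N; rewrite /p; nia.
rewrite nth_word_pow; last by move: jp; rewrite /p; lia.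
by congr nth; congr (_ %% _)%N; move: jp; rewrite /p; lia.
Qed.

(** When the whole word lies to the left of the seam, p matters only modulo the
    length of r. *)
Lemma seam_word_reduce (r r' : seq T) (k p : nat) : (0 < size r)%N ->
  exists2 p', (p' <= k + size r)%N & seam_word r r' k p = seam_word r r' k p'.
Proof.
move=> r0; have [pk|kp] := leqP p k; first by exists p; rewrite // (leq_trans pk) ?leq_addr.
pose p' := (k + (p - k) %% size r)%N; pose q := ((p - k) %/ size r)%N.
have pE : p = (p' + q * size r)%N.
  by rewrite /p' -addnA [(_ %% _ + _)%N]addnC -divn_eq subnKC // ltnW.
exists p'; first by rewrite leq_add2l ltnW // ltn_pmod.
apply: (@eq_from_nth _ a0); rewrite !size_mkseq // => j jk.
rewrite !nth_mkseq //.
have jp' : (j < p')%N by rewrite ltn_addr.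
rewrite jp' pE ltn_addr //; congr nth.
rewrite (_ : (_ - _)%N = ((q * (size r).-1) * size r + (p' * size r + j - p'))%N).
  by rewrite modnMDl.
by case: (size r) r0 => // r1 _ /=; nia.
Qed.

End Seams.

Section SadicComplexity.
Variables (A : finType) (s : sadic A).

Lemma sigma_upto_factor m n (a : alph s m) : (n <= m)%N ->
  exists u : seq (alph s n), sigma_upto a = flatten (map (@sigma_upto A s n) u).
Proof.
elim: m a => [|m IH] a.
  rewrite leqn0 => /eqP n0; move: a; rewrite -n0 => a.
  by exists [:: a]; rewrite /= cats0.
rewrite leq_eqVlt => /orP[/eqP nm|nm].
  by move: a; rewrite -nm => a; exists [:: a]; rewrite /= cats0.
rewrite -[sigma_upto a]/(flatten (map (@sigma_upto A s m) (sigma a))).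
elim: (sigma a) => [|b r [u uE]]; first by exists [::].
have [v vE] := IH b nm.
by exists (v ++ u); rewrite map_cat flatten_cat /= uE vE.
Qed.

Lemma sigma_upto_gt0 n (a : alph s n) : (0 < size (sigma_upto a))%N.
Proof.
elim: n a => [|n IH] a //.
rewrite -[sigma_upto a]/(flatten (map (@sigma_upto A s n) (sigma a))).
have := @morph_nonempty A s n a; rewrite -[morph _]/(sigma a).
by case: (sigma a) => // b r _; rewrite /= size_cat ltn_addr.
Qed.

Lemma size_flatten_map (B : Type) (f : B -> seq A) u k :
  (forall b, (size (f b) <= k)%N) -> (size (flatten (map f u)) <= size u * k)%N.
Proof.
by move=> fk; elim: u => //= b u IH; rewrite size_cat mulSn leq_add.
Qed.

Lemma factor_two_blocks (B : Type) (f : B -> seq A) (u : seq B) (i k : nat) :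
  (0 < k)%N -> (forall b, (k <= size (f b))%N) ->
  (i + k <= size (flatten (map f u)))%N ->
  exists b b' i', (i' <= size (f b))%N /\
    take k (drop i (flatten (map f u))) = take k (drop i' (f b ++ f b')).
Proof.
move=> k0 kf; elim: u i => [|b u IH] i /=; first by lia.
rewrite size_cat drop_cat; case: ltnP => [ib ik | bi ik]; last first.
  by apply: IH; rewrite addnBAC // leq_subLR.
case: u {IH} ik => [|b' u] ik.
  exists b, b, i; split; first exact: ltnW.
  rewrite cats0 drop_cat ib takel_cat // size_drop; move: ik; rewrite /=; lia.
exists b, b', i; split; first exact: ltnW.
rewrite drop_cat ib /= catA takel_cat // size_cat size_drop.
by have := kf b'; lia.
Qed.

Lemma complexity_le (X : set (fullshift A)) k (L : seq (seq A)) :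
  (forall w : seq A, size w = k -> (exists2 x, X x & occurs_in w x) -> w \in L) ->
  (complexity X k <= size L)%N.
Proof.
move=> LP; rewrite /complexity cardE -(size_map val).
apply: uniq_leq_size; first by rewrite map_inj_uniq ?enum_uniq //; exact: val_inj.
move=> _ /mapP[w + ->]; rewrite mem_enum inE => /asboolP ex.
by apply: LP; [exact: size_tuple | exact: asboolW ex].
Qed.

Lemma infix_window (x : fullshift A) i j m n : i <= j -> j + m%:Z <= i + n%:Z ->
  infix (window x j m) (window x i n).
Proof.
move=> ij jm; apply/infixP.
exists (window x i `|(j - i)%R|), (window x (j + m%:Z) (n - `|(j - i)%R| - m)).
have -> : n = (`|(j - i)%R| + (m + (n - `|(j - i)%R| - m)))%N by lia.
rewrite !window_cat (_ : i + `|(j - i)%R|%:Z = j); last by lia.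
by congr (_ ++ (_ ++ window _ _ _)); lia.
Qed.

(** Take the first level n0 at which all values have length at least k. Since the
    level below fails, the values at level n0 have length at most d^2 k. A word of
    length k meets at most two consecutive values, which are powers of two of the
    at most d roots: it is the seam word of these roots for some p at most
    k + d^2 k. *)
Lemma linear_of_sadic X d :
  (0 < #|A|)%N -> generates s X -> X !=set0 -> (0 < d)%N ->
  (forall n, exists2 L : seq (seq A), (size L <= d)%N &
     forall a : alph s n, root_word (sigma_upto a) \in L) ->
  (forall n (a b : alph s n),
     (size (sigma_upto a) <= d * size (sigma_upto b))%N) ->
  (forall n (a : alph s n.+1), (size (sigma a) <= d)%N) ->
  exists c, forall k, (0 < k)%N -> (complexity X k <= c * k)%N.
Proof.
move=> A0 gen [x0 X0] d0 roots bal short.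
case/card_gt0P: (A0) => a0 _.
exists (d * d * (2 + d * d))%N => k k0.
have genP x l : X x -> exists2 n, (1 <= n)%N & exists a : alph s n,
    infix (window x (- l%:Z) l.*2) (sigma_upto a).
  by rewrite -gen => /(_ l) [n [n1 h]]; exists n.
pose large n := [forall a : alph s n, (k <= size (sigma_upto a))%N].
have ex : exists n, large n.
  have [n _ [a /size_infix]] := genP x0 (d * k)%N X0.
  rewrite size_mkseq => sz; exists n; apply/forallP => b.
  rewrite -(leq_pmul2l d0); apply: leq_trans (bal n a b).
  by apply: leq_trans sz; rewrite -addnn leq_addr.
case: (ex_minnP ex) => n0 /forallP ln0 min.
have small m (a : alph s m) : (m < n0)%N -> (size (sigma_upto a) <= d * k)%N.
  move=> mn; have : ~~ large m by apply/negP => /min; rewrite leqNgt mn.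
  rewrite negb_forall => /existsP[b]; rewrite -ltnNge => bk.
  by apply: leq_trans (bal m a b) _; rewrite leq_mul2l ltnW ?orbT.
have upper (a : alph s n0) : (size (sigma_upto a) <= d * d * k)%N.
  case: n0 a {ln0 min} small => [|m] a small; first by rewrite /= !muln_gt0 d0.
  rewrite -[sigma_upto a]/(flatten (map (@sigma_upto A s m) (sigma a))) -mulnA.
  apply: leq_trans (size_flatten_map (k := (d * k)%N) _ _) _.
    by move=> b; apply: small.
  by rewrite leq_mul2r short orbT.
have [R Rd RP] := roots n0.
pose L := [seq seam_word a0 rr.1 rr.2 k p | rr <- [seq (r, r') | r <- R, r' <- R],
                                       p <- iota 0 (k + d * d * k).+1].
have sizeL : (size L <= d * d * (2 + d * d) * k)%N.
  rewrite !size_allpairs size_iota; apply: (@leq_trans (d * d * (k + d * d * k).+1)).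
    by rewrite leq_mul // leq_mul.
  by rewrite -[leqRHS]mulnA leq_mul2l; apply/orP; right; lia.
apply: leq_trans sizeL; apply: complexity_le => w wk [z Xz [i wi]].
pose l := (`|i| + k + d * k)%N.
have [m _ [a inf]] := genP z l Xz.
have nm : (n0 <= m)%N.
  rewrite leqNgt; apply/negP => lt; have := leq_trans (size_infix inf) (small m a lt).
  by rewrite size_mkseq /l; lia.
have [u uE] := sigma_upto_factor a nm.
have : infix w (sigma_upto a).
  by apply: infix_trans inf; rewrite -wi wk; apply: infix_window; rewrite /l; lia.
case/infixP => s1 [s2 aE].
have [||b [b' [i' [ib E]]]] := @factor_two_blocks _ (@sigma_upto A s n0) u (size s1) k k0.
- exact: ln0.
- by rewrite -uE aE !size_cat wk addnA leq_addr.
have wE : w = take k (drop i' (sigma_upto b ++ sigma_upto b')).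
  by rewrite -E -uE aE drop_size_cat ?take_size_cat.
have [m1 m1_gt0 bE] := root_wordP (sigma_upto b).
have [m2 m2_gt0 bE'] := root_wordP (sigma_upto b').
have r0 : (0 < size (root_word (sigma_upto b)))%N.
  by have := sigma_upto_gt0 b; rewrite {1}bE size_word_pow muln_gt0 => /andP[].
have ib' : (i' <= m1 * size (root_word (sigma_upto b)))%N by rewrite -size_word_pow -bE.
have kb' : (k <= m2 * size (root_word (sigma_upto b')))%N by rewrite -size_word_pow -bE'.
have := seam_wordE a0 r0 ib' kb'; rewrite -bE -bE' -wE => ->.
have [p' p'le ->] := seam_word_reduce a0 (root_word (sigma_upto b')) k
  (m1 * size (root_word (sigma_upto b)) - i') r0.
apply/allpairsP; exists ((root_word (sigma_upto b), root_word (sigma_upto b')), p').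
split=> //.
  apply/allpairsP; exists (root_word (sigma_upto b), root_word (sigma_upto b')).
  by split=> //=; apply: RP.
rewrite mem_iota /= add0n ltnS (leq_trans p'le) // leq_add2l.
apply: leq_trans (upper b); rewrite [in leqRHS]bE size_word_pow.
by rewrite leq_pmull.
Qed.

End SadicComplexity.

(** * Minimality and recurrence *)

Section Recurrence.
Variable A : finType.
Implicit Types (x y z : fullshift A) (X : set (fullshift A)) (i j k : int).

Lemma nbhs_cylinder y i n : nbhs y [set z | window z i n = window y i n].
Proof.
have one j : nbhs y [set z | z j = y j].
  have := @proj_continuous int (fun=> discrete_topology A) j y.
  move=> /(_ [set y j]); apply.
  exact: discrete_set1.
elim: n => [|n IH]; first exact: filterE.
rewrite -addn1; apply: filterS (filterI IH (one (i + n%:Z))) => z [zn zi] /=.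
by rewrite !window_cat zn /window /mkseq /= addr0 zi.
Qed.

Lemma fullshift_compact : compact [set: fullshift A].
Proof.
have fin : finite_set [set: discrete_topology A] by exact: (@finite_finset A).
have := @tychonoff int (fun=> discrete_topology A) (fun=> setT) (fun=> finite_compact fin).
by set B := (X in compact X -> _); rewrite (_ : B = setT) // eqEsubset.
Qed.

Lemma cluster_point X (u : nat -> fullshift A) : closed X -> (forall n, X (u n)) ->
  exists2 p, X p & forall i n N, exists2 m, (N <= m)%N & window (u m) i n = window p i n.
Proof.
move=> clX Xu.
have cX := subclosed_compact clX fullshift_compact (@subsetT _ X).
have [|p [Xp cp]] := cX (u @ \oo); first by exists 0%N => // n _; apply: Xu.
exists p => // i n N.
have [_ [[m /= Nm <-] eqw]] := cp (u @` [set m | (N <= m)%N]) _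
  (ltac:(by exists N => // m Nm; exists m)) (nbhs_cylinder p i n).
by exists m.
Qed.

Definition translate k x : fullshift A := fun n => x (n + k).

Lemma window_translate k x i n : window (translate k x) i n = window x (i + k) n.
Proof. by apply: eq_map => m; rewrite /translate addrAC. Qed.

Lemma translate_closed X k x : shift_invariant X -> X x -> X (translate k x).
Proof.
move=> inv.
have fwd y : X y -> X (translate 1 y) by move=> Xy; rewrite -inv; exists y.
have bwd y : X y -> X (translate (-1) y).
  rewrite -{1}inv => -[z Xz <-]; rewrite (_ : translate _ _ = z) //.
  by apply/funext => n; rewrite /translate /Defs.shift; congr (z _); lia.
have trD a b y : translate a (translate b y) = translate (a + b) y.
  by apply/funext => n; rewrite /translate addrA.
move=> Xx; case: k => n.
  elim: n => [|n IH]; last by rewrite -[n.+1]add1n PoszD -trD; apply: fwd.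
  by rewrite (_ : translate _ _ = x) //; apply/funext => m; rewrite /translate addr0.
rewrite NegzE; elim: n => [|n IH]; first exact: bwd.
rewrite (_ : - n.+2%:Z = -1 + - n.+1%:Z); last by lia.
by rewrite -trD; apply: bwd.
Qed.

(** Shifted points of X agree with y on larger and larger windows around the
    origin; y is the limit of them. *)
Lemma subshift_mem X y : subshift X ->
  (forall l : nat, exists2 z, X z & exists j, window z j l.*2 = window y (- l%:Z) l.*2) ->
  X y.
Proof.
move=> [clX inv] ex.
have exu l : {u | X u & window u (- l%:Z) l.*2 = window y (- l%:Z) l.*2}.
  apply: cid2; have [z Xz [j zj]] := ex l.
  exists (translate (j + l%:Z) z); first exact: translate_closed.
  by rewrite window_translate -zj; congr window; lia.
have [p Xp cp] := cluster_point clX (fun l => s2valP (exu l)).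
suff -> : y = p by [].
apply/funext => t; have [m tm] := cp t 1%N (`|t|.+1)%N.
have := s2valP' (exu m); move: (s2val _) => u uy.
rewrite /window /mkseq /= addr0 => -[<-].
have := congr1 (fun w => nth (y t) w `|(t + m%:Z)%R|) uy.
have mt : (`|(t + m%:Z)%R| < m.*2)%N by lia.
rewrite !nth_mkseq // (_ : - m%:Z + `|(t + m%:Z)%R|%:Z = t) //; lia.
Qed.

(** Otherwise longer and longer windows of points of X avoid w; a limit of them
    avoids w altogether, and the points of X avoiding w form a proper subshift. *)
Lemma minimal_recurrence X w x : minimal_subshift X -> X x -> occurs_in w x ->
  exists g : nat, forall z, X z -> forall i, exists j,
    [/\ i <= j, j + (size w)%:Z <= i + g%:Z & window z j (size w) = w].
Proof.
move=> [[clX inv] _ min] Xx wx; apply: contrapT => no.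
pose avoid (n : nat) z := forall j, - n%:Z <= j -> j + (size w)%:Z <= n%:Z ->
  window z j (size w) <> w.
have exu n : {u | X u & avoid n u}.
  apply: cid2; apply: contrapT => nu; apply: no; exists (n + n)%N => z Xz i.
  apply: contrapT => nj; apply: nu; exists (translate (i + n%:Z) z).
    exact: translate_closed.
  move=> j j1 j2; rewrite window_translate => eqw; apply: nj.
  by exists (j + (i + n%:Z)); split=> //; lia.
have [p Xp cp] := cluster_point clX (fun l => s2valP (exu l)).
pose Y := [set z | X z /\ ~ occurs_in w z].
have Yp : Y p.
  split=> // -[j pj]; have [m jm] := cp j (size w) (`|j| + size w)%N.
  by rewrite pj; apply: (s2valP' (exu m)); lia.
have [|||Y0|YX] := min Y.
- by move=> z [].
- rewrite (_ : Y = X `&` ~` [set z | occurs_in w z]) //.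
  apply: closedI => //; rewrite closedC openE => z [j zj].
  apply: filterS (nbhs_cylinder z j (size w)) => z' /= z'j.
  by exists j; rewrite z'j.
- rewrite /shift_invariant eqEsubset; split=> [_ [z [Xz nz] <-]|z [Xz nz]].
    split; first by rewrite -inv; exists z.
    move=> [j zj]; apply: nz; exists (j + 1); rewrite -[RHS]zj.
    by rewrite -[Defs.shift z]/(translate 1 z) window_translate.
  exists (translate (-1) z); last first.
    by apply/funext => t; rewrite /translate /Defs.shift; congr (z _); lia.
  split; first exact: translate_closed.
  by move=> [j zj]; apply: nz; exists (j - 1); rewrite -[RHS]zj window_translate.
- by move: Yp; rewrite Y0.
- by move: Xx; rewrite -YX => -[].
Qed.

End Recurrence.

Lemma linear_growthP (R : realType) (A : finType) (X : set (fullshift A)) :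
  linear_growth R X <->
  exists c, forall k, (0 < k)%N -> (complexity X k <= c * k)%N.
Proof.
rewrite /linear_growth /limn_esup /limf_esup; split.
  move=> /ereal_inf_lt[_ [V [N _ NV] <-]] Vfin.
  have [r rP] : exists r : R, forall k, (N <= k)%N -> (0 < k)%N ->
      ((complexity X k)%:R <= r * k%:R)%R.
    move: Vfin; set M := ereal_sup _ => Mfin.
    exists (fine M) => k Nk k0.
    have uM : (((complexity X k)%:R / k%:R : R)%:E <= M)%E.
      by apply: ereal_sup_ubound; exists k => //; apply: NV.
    case: M Mfin uM => [m _| //|_]; last by rewrite leNgt ltNyr.
    by rewrite lee_fin ler_pdivrMr ?ltr0n.
  exists (Num.bound `|r| + \sum_(k < N.+1) complexity X k)%N => k k0.
  have [Nk|kN] := leqP N k.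
    rewrite mulnDl; apply: leq_trans (leq_addr _ _).
    have := rP k Nk k0; rewrite -(ler_nat R) natrM => /le_trans; apply.
    rewrite ler_wpM2r ?ler0n //.
    exact: le_trans (ler_norm r) (ltW (archi_boundP (normr_ge0 r))).
  apply: (@leq_trans (\sum_(k < N.+1) complexity X k)).
    have kN' : (k < N.+1)%N by apply: leq_trans kN _.
    by rewrite (bigD1 (Ordinal kN')) //= leq_addr.
  by rewrite mulnDl; apply: leq_trans (leq_addl _ _); rewrite leq_pmulr.
move=> [c cP]; apply: (@le_lt_trans _ _ (c%:R : R)%:E); last exact: ltry.
apply: le_trans (ereal_inf_lbound _) _.
  by exists setT; [exact: filterT | reflexivity].
apply: ge_ereal_sup => _ [k _ <-]; rewrite lee_fin.
have [->|k0] := posnP k; first by rewrite invr0 mulr0.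
by rewrite ler_pdivrMr ?ltr0n // -natrM ler_nat cP.
Qed.

(** * The characterization *)

Section Aperiodicity.
Variables (A : finType) (X : set (fullshift A)) (x : fullshift A).
Hypotheses (minX : minimal_subshift X) (Xx : X x).

(** By recurrence every word of length q+1 occurs in the periodic half. *)
Lemma right_periodic (q y : int) : 0 < q ->
  (forall t, y <= t -> x (t + q) = x t) -> forall t, x (t + q) = x t.
Proof.
move=> q0 per t; pose w := window x t `|q|.+1.
have [|g gP] := minimal_recurrence minX Xx (w := w).
  by exists t; rewrite size_mkseq.
have [j [yj _]] := gP x Xx y; rewrite size_mkseq => /window_eqP ag.
have := ag 0; rewrite !addr0 => <-; [|lia|lia].
by rewrite -ag ?per; [|lia|lia|lia].
Qed.

Lemma left_periodic (q y : int) : 0 < q ->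
  (forall t, t <= y -> x (t - q) = x t) -> forall t, x (t + q) = x t.
Proof.
move=> q0 per t; pose w := window x t `|q|.+1.
have [|g gP] := minimal_recurrence minX Xx (w := w).
  by exists t; rewrite size_mkseq.
have [j [_ jy]] := gP x Xx (y - g%:Z); rewrite size_mkseq in jy *.
move=> /window_eqP ag.
have := ag 0; rewrite !addr0 => <-; [|lia|lia].
by rewrite -ag -?(per (j + q)) ?addrK //; lia.
Qed.

Lemma words_complexity n : (#|words x n| <= complexity X n)%N.
Proof.
rewrite /complexity; apply: subset_leq_card; apply/fintype.subsetP => w.
move=> /in_words[i ->].
by rewrite inE; exists x => //; exists i; rewrite size_tuple.
Qed.

Lemma linear_word_system c :
  (forall k, (0 < k)%N -> (complexity X k <= c * k)%N) ->
  exists d W, word_system x d W.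
Proof.
move=> lin; have linw k : (0 < k)%N -> (#|words x k| <= c * k)%N.
  by move=> k0; apply: leq_trans (words_complexity k) (lin k k0).
have [[q q0 per]|aper] := pselect
  (exists2 q : nat, (0 < q)%N & forall t, x (t + q%:Z) = x t).
  exact: periodic_word_system q0 per.
have aper' (q : int) : 0 < q -> ~ forall t, x (t + q) = x t.
  move=> q0 per; apply: aper; exists `|q|%N; first by lia.
  by move=> t; rewrite -[RHS]per; congr (x _); lia.
apply: aperiodic_word_system linw _ _ => q y q0 per; apply: (aper' q q0).
  exact: right_periodic per.
exact: left_periodic per.
Qed.

(** Every word of the generated subshift is a word of x, and by recurrence every
    word of X lies in each of the values that are long enough. *)
Lemma word_system_generates d W (s : sadic A) : word_system x d W ->
  (forall n (a : alph s n.+1), W n (sigma_upto a)) -> generates s X.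
Proof.
move=> ws sW; rewrite /generates eqEsubset; split=> y.
  move=> gen; apply: subshift_mem (proj1 _) _; first by case: minX.
  move=> l; exists x => //; have [n [n1 [a inf]]] := gen l.
  case: n n1 a inf => // n _ a inf.
  have [i xi] := ws_window ws (sW n a).
  have /infixP[u [v uv]] := inf.
  exists (i + (size u)%:Z).
  move: xi; rewrite uv size_cat size_cat window_cat => /eqP.
  rewrite eqseq_cat ?size_mkseq // => /andP[_]; rewrite window_cat eqseq_cat ?size_mkseq //.
  by move=> /andP[/eqP].
move=> Xy l; pose w := window y (- l%:Z) l.*2.
have [|g gP] := minimal_recurrence minX Xy (w := w).
  by exists (- l%:Z); rewrite size_mkseq.
exists g.+1; split=> //.
have /card_gt0P[a _] := @alph_nonempty A s g.+1.
exists a; have Wa := sW g a.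
have [i xi] := ws_window ws Wa; have long := ws_long ws Wa.
have [j [ij jg wj]] := gP x Xx i.
rewrite -/w -wj -xi; apply: infix_window => //.
by apply: le_trans jg _; rewrite lerD2l lez_nat ltnW.
Qed.

End Aperiodicity.

Lemma card_imfset_le (T : finType) (U : choiceType) (f : T -> U) (L : seq U) :
  (forall a, f a \in L) -> (#|` [fset f a | a : T]%fset| <= size L)%N.
Proof.
move=> fL; apply: (@leq_trans #|` [fset u in L]%fset|).
  by apply: fsubset_leq_card; apply/fsubsetP => _ /imfsetP[a _ ->]; rewrite inE fL.
by rewrite card_fseq size_undup.
Qed.

Theorem theorem1 (R : realType) (A : finType) (A_nonempty : (0 < #|A|)%N)
    (X : set (fullshift A)) (X_minimal : minimal_subshift X) :
  linear_growth R X <->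
  exists (d : R) (s : sadic A),
    [/\ 0 < d,
        generates s X,
        (forall n : nat,
           (#|` [fset root_word (sigma_upto a) | a : alph s n]%fset|)%:R <= d),
        (forall (n : nat) (a b : alph s n),
           (size (sigma_upto a))%:R <= d * (size (sigma_upto b))%:R) &
        (forall (n : nat) (a : alph s n.+1), (size (sigma a))%:R <= d)].
Proof.
have [_ [x Xx] _] := X_minimal; rewrite linear_growthP; split.
  move=> [c lin]; have [d [W ws]] := linear_word_system X_minimal Xx lin.
  have [s [sW sd]] := sadic_of_word_system A_nonempty ws.
  exists (d + #|A|)%:R, s; split.
  - by rewrite ltr0n addn_gt0 A_nonempty orbT.
  - exact: (word_system_generates X_minimal Xx ws sW).
  - case=> [|n]; rewrite ler_nat.
      apply: leq_trans (leq_addl _ _).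
      apply: leq_trans (card_imfset_le (L := [seq root_word [:: a] | a <- enum A]) _) _.
        by move=> a; apply/mapP; exists a; rewrite // mem_enum.
      by rewrite size_map -cardE.
    apply: leq_trans (leq_addr _ _); have [L Ld LP] := ws_roots ws n.
    apply: leq_trans Ld; apply: card_imfset_le => a; apply: LP.
    by exists (sigma_upto a).
  - case=> [|n] a b; rewrite -natrM ler_nat.
      by rewrite /= muln1 addn_gt0 A_nonempty orbT.
    apply: leq_trans (ws_balanced ws (sW n a) (sW n b)) _.
    by rewrite leq_mul2r leq_addr orbT.
  - by move=> n a; rewrite ler_nat; apply: leq_trans (sd n a) (leq_addr _ _).
move=> [d [s [d0 gen roots bal short]]]; pose D := Num.bound d.
have dD : d <= D%:R by exact: ltW (archi_boundP (ltW d0)).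
have D0 : (0 < D)%N by rewrite -(ltr0n R); apply: lt_le_trans dD.
apply: (linear_of_sadic A_nonempty gen _ D0).
- by exists x.
- move=> n; exists [fset root_word (sigma_upto a) | a : alph s n]%fset.
    by rewrite -(ler_nat R); apply: le_trans (roots n) dD.
  by move=> a; apply/imfsetP; exists a.
- move=> n a b; rewrite -(ler_nat R) natrM; apply: le_trans (bal n a b) _.
  by rewrite ler_wpM2r.
- by move=> n a; rewrite -(ler_nat R); apply: le_trans (short n a) dD.
Qed.
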